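(* Let $\alpha \in \overline{\mathbf{C}} \setminus \{0, 1, \infty\}$, let $U \subset \overline{\mathbf{C}}$ be a domain, and let $f : U \to \overline{\mathbf{C}}$ be a continuous mapping which satisfies the condition $\varphi(K, \alpha)$. Then $f$ is either a constant or (the restriction to $U$ of) a Moebius transformation. If moreover $\alpha$ is not a real number, then $f$ is either a constant or (the restriction to $U$ of) a linear-fractional function.
   Context: $\overline{\mathbf{C}} = \mathbf{C} \cup \{\infty\}$ is the extended complex plane (Riemann sphere); a domain is a nonempty connected open subset. Tetrads: $\mathbf{T}$ is the set of all ordered quadruples (tetrads) $T = \{z_1, z_2, z_3, z_4\}$ of points of $\overline{\mathbf{C}}$ in which no three elements coincide. A tetrad is nonsingular if its four elements are pairwise different. Anharmonic ratio: for a tetrad of pairwise different finite points, $A(T) = \dfrac{(z_1 - z_3)(z_2 - z_4)}{(z_3 - z_2)(z_4 - z_1)}$. For an arbitrary $T \in \mathbf{T}$, $A(T) \in \overline{\mathbf{C}}$ is the (finite or infinite) limit of $\dfrac{(w_1 - w_3)(w_2 - w_4)}{(w_3 - w_2)(w_4 - w_1)}$ as $w_i \to z_i$ ($i = 1,2,3,4$) over nonsingular tetrads $\{w_1, w_2, w_3, w_4\}$; this limit always exists. For example, $A(\{z_1,z_2,z_3,\infty\}) = -(z_1-z_3)/(z_3-z_2)$ for distinct finite $z_1,z_2,z_3$. One has $A(T) \notin \{0,1,\infty\}$ if and only if $T$ is nonsingular. Condition $\varphi(K,\alpha)$: for $\alpha \notin \{0,1,\infty\}$, a mapping $f : U \to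 \overline{\mathbf{C}}$ of a domain $U \subset \overline{\mathbf{C}}$ satisfies the condition $\varphi(K, \alpha)$ if for every tetrad $T = \{z_1, z_2, z_3, z_4\} \in \mathbf{T}$ of points of $U$ with $A(T) = \alpha$ and such that $f(T) := \{f(z_1), f(z_2), f(z_3), f(z_4)\}$ belongs to $\mathbf{T}$, one has $A(f(T)) = \alpha$. A linear-fractional function is a map $z \mapsto (az+b)/(cz+d)$ of $\overline{\mathbf{C}}$ with $a,b,c,d \in \mathbf{C}$, $ad - bc \neq 0$. A Moebius transformation is a composition of finitely many reflections (inversions) in generalized circles (circles, and straight lines together with $\infty$) of $\overline{\mathbf{C}}$; equivalently, it is a linear-fractional function or the complex conjugate of a linear-fractional function. *)

(* Defs.v *)
From mathcomp Require Import all_boot all_order all_algebra.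
From mathcomp Require Import all_classical all_reals all_analysis.
From mathcomp Require Export complex.
Import Order.TTheory GRing.Theory Num.Theory numFieldNormedType.Exports.

Set Implicit Arguments.
Unset Strict Implicit.
Unset Printing Implicit Defensive.

Local Open Scope classical_set_scope.
Local Open Scope ring_scope.
Local Open Scope complex_scope.

(* [R[i]^o] is [R[i]] carrying the topology of its norm. *)
Definition sphere (R : realType) : Type :=
  one_point_compactification (R[i]^o).

Definition finpt (R : realType) (z : R[i]) : sphere R := Some z.
Definition infpt (R : realType) : sphere R := None.
Arguments infpt {R}.

Definition domain (R : realType) (U : set (sphere R)) : Prop :=
  [/\ U !=set0, open U & connected U].

Definition quad (R : realType) : Type :=
  (sphere R * sphere R * sphere R * sphere R)%type.

Definition quad_in (R : realType) (U : set (sphere R)) (T : quad R) : Prop :=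
  let: (z1, z2, z3, z4) := T in [/\ U z1, U z2, U z3 & U z4].

Definition quad_map (R : realType) (f : sphere R -> sphere R) (T : quad R)
    : quad R :=
  let: (z1, z2, z3, z4) := T in (f z1, f z2, f z3, f z4).

Definition tetrad (R : realType) (T : quad R) : Prop :=
  let: (z1, z2, z3, z4) := T in
  [/\ ~ (z1 = z2 /\ z2 = z3), ~ (z1 = z2 /\ z2 = z4),
      ~ (z1 = z3 /\ z3 = z4) & ~ (z2 = z3 /\ z3 = z4)].

Definition nonsingular (R : realType) (T : quad R) : Prop :=
  let: (z1, z2, z3, z4) := T in uniq [:: z1; z2; z3; z4].

(* The last branch is never used: see [anharmonic]. *)
Definition cross_ratio (R : realType) (W : quad R) : sphere R :=
  if W is (Some w1, Some w2, Some w3, Some w4) then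
    finpt (((w1 - w3) * (w2 - w4)) / ((w3 - w2) * (w4 - w1)))
  else infpt.

(* The limit is taken in the product topology, over the nonsingular quadruples
   of finite points, which are those where the formula makes sense; it exists
   whenever [tetrad T], and the value is irrelevant for the other [T]. *)
Definition anharmonic (R : realType) (T : quad R) : sphere R :=
  lim (@cross_ratio R @
    within [set W | nonsingular W /\ quad_in (range (@finpt R)) W] (nbhs T)).

(* [f] is a total function, but only its values on [U] matter. *)
Definition phi_cond (R : realType) (alpha : sphere R) (U : set (sphere R))
    (f : sphere R -> sphere R) : Prop :=
  forall T : quad R, tetrad T -> quad_in U T -> anharmonic T = alpha ->
    tetrad (quad_map f T) -> anharmonic (quad_map f T) = alpha.

Definition lin_frac (R : realType) (a b c d : R[i]) (z : sphere R) : sphere R :=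
  match z with
  | Some z => if c * z + d == 0 then infpt
              else finpt ((a * z + b) / (c * z + d))
  | None => if c == 0 then infpt else finpt (a / c)
  end.

Definition is_lin_frac (R : realType) (g : sphere R -> sphere R) : Prop :=
  exists a b c d : R[i], a * d - b * c != 0 /\ g = lin_frac a b c d.

Definition circle_refl (R : realType) (p : R[i]) (r : R) (z : sphere R)
    : sphere R :=
  match z with
  | Some z => if z == p then infpt else finpt (p + (r ^+ 2)%:C / conjc (z - p))
  | None => finpt p
  end.

(* Reflection in the line through [p] with direction [u]; note that
   [u / conjc u = (u / |u|) ^+ 2]. *)
Definition line_refl (R : realType) (p u : R[i]) (z : sphere R) : sphere R :=
  match z with
  | Some z => finpt (p + u / conjc u * conjc (z - p))
  | None => infpt
  end.

Inductive reflection (R : realType) : (sphere R -> sphere R) -> Prop :=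
| reflection_circle (p : R[i]) (r : R) :
    0 < r -> reflection (circle_refl p r)
| reflection_line (p u : R[i]) :
    u != 0 -> reflection (line_refl p u).

Inductive moebius (R : realType) : (sphere R -> sphere R) -> Prop :=
| moebius_id : moebius id
| moebius_comp (s g : sphere R -> sphere R) :
    reflection s -> moebius g -> moebius (s \o g).

Definition constant_on (R : realType) (U : set (sphere R))
    (f : sphere R -> sphere R) : Prop :=
  exists c : sphere R, forall z, U z -> f z = c.

Definition is_real_point (R : realType) (z : sphere R) : Prop :=
  exists x : R, z = finpt x%:C.

(* Main.v *)
(* The anharmonic ratio of a tetrad is a quotient of brackets
   [z,w] = x_z y_w - x_w y_z of homogeneous coordinates, hence invariant under
   linear-fractional maps; so any point b and its image may be moved to infinity.
   There a tetrad (c, y, x, infinity) has ratio a exactly when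
   c = (1 - a) x + a y.

   If f b = infinity = b, the condition says that x, y, c never contain exactly
   two points with a finite image. As |l| + |1 - l| > 1 for l = a or
   l = 1 / (1 - a), a small disc of points with finite image grows until it
   leaves U. Hence a point p <> b with f p = infinity is interior to its fiber,
   and by connectedness f is constant as soon as it is not injective.

   If f is injective, f ((1 - a) x + a y) = (1 - a) f x + a f y makes f - f p
   additive, hence real linear, near a finite point p. For nonreal a this map
   commutes with a, so it is complex linear; for real a the points 0, 1 - a,
   i - a, 1 + a i, which have ratio a, force the images A and B of 1 and i to
   satisfy A^2 + B^2 = 0. So f agrees near p with a Moebius transformation g,
   and f z = g z everywhere because z is the fourth point of a tetrad of ratio a
   whose other three points are near p. *)

Require Import Defs.
From mathcomp Require Import all_boot all_order all_algebra.
From mathcomp Require Import all_classical all_reals all_analysis.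
From mathcomp Require Import ring lra.
Import Order.TTheory GRing.Theory Num.Theory numFieldNormedType.Exports.
Import ComplexField.Normc.

Set Implicit Arguments.
Unset Strict Implicit.
Unset Printing Implicit Defensive.

Local Open Scope classical_set_scope.
Local Open Scope ring_scope.
Local Open Scope complex_scope.

Local Notation Re := complex.Re.
Local Notation Im := complex.Im.

(** * The topology of the sphere *)

Section ComplexPlane.
Variable R : realType.
Implicit Types (x y z : R[i]) (e r : R).

Lemma normc_norm z : `|z| = (normc z)%:C. Proof. by case: z. Qed.

Lemma normc_ge0 z : 0 <= normc z.
Proof. by rewrite -lecR -normc_norm normr_ge0. Qed.

Lemma normc_gt0 z : (0 < normc z) = (z != 0).
Proof. by rewrite -ltcR -normc_norm normr_gt0. Qed.

Lemma normc_real e : normc e%:C = `|e|.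
Proof. by rewrite /= expr0n /= addr0 sqrtr_sqr. Qed.

Lemma normc_distC x y : normc (x - y) = normc (y - x).
Proof. by rewrite -normcN opprB. Qed.

Lemma normr_Re_le z : `|Re z| <= normc z.
Proof. by rewrite -lecR -normc_norm; exact: normc_ge_Re. Qed.

Lemma normr_Im_le z : `|Im z| <= normc z.
Proof.
case: z => a b /=; rewrite -[leLHS]sqrtr_sqr ler_sqrt ?addr_ge0 ?sqr_ge0//.
by rewrite lerDr sqr_ge0.
Qed.

Lemma normc_le_ReIm z : normc z <= `|Re z| + `|Im z|.
Proof.
case: z => a b; have -> : a +i* b = a%:C + 0 +i* b by simpc.
apply: (le_trans (le_normcD _ _)).
by rewrite normc_real /= expr0n /= add0r sqrtr_sqr; simpc.
Qed.

(** The norm of [R[i]] takes its values in [R[i]]; the estimates below use the real-valued [normc]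
    and real radii instead. *)
Lemma nbhs_normc (x : R[i]^o) (A : set R[i]^o) :
  nbhs x A <-> exists2 e, 0 < e & forall y, normc (y - x) < e -> A y.
Proof.
apply: (iff_trans (nbhs_normP x A)); split.
  case=> e /= e0 eA; have er : (Re e)%:C = e by apply: RRe_real; exact: gtr0_real.
  exists (Re e) => [|y yx]; first by rewrite -ltcR er.
  by apply: eA => /=; rewrite distrC normc_norm -er ltcR.
case=> e e0 eA; exists e%:C => /=; first by rewrite ltcR.
by move=> y /=; rewrite normc_norm ltcR normc_distC; exact: eA.
Qed.

Lemma Complex_continuous :
  continuous ((fun p => Complex p.1 p.2) : R * R -> R[i]^o).
Proof.
move=> [a b] A /nbhs_normc[e e0 eA].
have e20 : 0 < e / 2 by rewrite divr_gt0.
exists (ball a (e / 2), ball b (e / 2)) => /=.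
  by split; exact: nbhsx_ballx.
move=> [c d] [/= ca db]; apply: eA; apply: le_lt_trans (normc_le_ReIm _) _.
move: ca db; rewrite -!ball_normE /= ![`|_ - c|]distrC ![`|_ - d|]distrC /=.
by lra.
Qed.

Lemma normc_continuous : continuous (@normc R : R[i]^o -> R).
Proof.
move=> x A /nbhs_ballP[e /= e0 eA]; apply/nbhs_normc; exists e => // y yx.
apply: eA; rewrite -ball_normE /=.
have h1 := le_normcD (y - x) x; have h2 := le_normcD (x - y) y.
rewrite subrK in h1; rewrite subrK in h2; rewrite normc_distC in h2.
by rewrite ltr_norml; lra.
Qed.

(** The disc is a closed subset of the continuous image of the compact square with sides [-r, r]. *)
Lemma closed_disc_compact r :
  compact [set z : R[i]^o | normc z <= r] /\
  closed [set z : R[i]^o | normc z <= r].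
Proof.
have cl : closed [set z : R[i]^o | normc z <= r].
  apply: (closed_comp (f := @normc R : R[i]^o -> R) (D := [set y | y <= r])).
    by move=> x _; exact: normc_continuous.
  exact: closed_le.
split => //.
pose K := ((fun p => Complex p.1 p.2) : R * R -> R[i]^o) @`
  (`[- r, r] `*` `[- r, r]).
apply: (@subclosed_compact _ _ K) => //.
  apply: continuous_compact.
    by apply: continuous_subspaceT; exact: Complex_continuous.
  by apply: compact_setX; exact: segment_compact.
move=> [a b] /= ab; exists (a, b) => //=.
have := normr_Re_le (a +i* b); have := normr_Im_le (a +i* b).
rewrite !ler_norml => /= /andP[? ?] /andP[? ?].
by split; rewrite /= in_itv /=; apply/andP; split; lra.
Qed.

Lemma compact_normc_bounded (K : set R[i]^o) :
  compact K -> exists r, forall z, K z -> normc z <= r.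
Proof.
move=> cK.
have : compact ((@normc R : R[i]^o -> R) @` K).
  apply: continuous_compact => //.
  by apply: continuous_subspaceT; exact: normc_continuous.
move/compact_bounded => [M [_ MK]].
exists (M + 1) => z Kz; apply: le_trans (ler_norm _) _.
by apply: (MK (M + 1)); [rewrite ltrDl|exists z].
Qed.

End ComplexPlane.

(** * Neighbourhoods of infinity and affine coordinates on the sphere *)

Section Charts.
Variable R : realType.
Implicit Types (b s z w : sphere R) (u x y : R[i]).

Lemma sphere_hausdorff : hausdorff_space (sphere R).
Proof.
apply: one_point_compactification_hausdorff; last exact: norm_hausdorff.
move=> x _; exists [set z : R[i]^o | normc z <= normc x + 1].
  apply/nbhs_normc; exists 1 => // y yx /=.
  by have := le_normcD (y - x) x; rewrite subrK; lra.
by have [] := closed_disc_compact (normc x + 1).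
Qed.

(* [chart b] is a coordinate on the complement of [b], with inverse
   [ichart b]; the value at [b] is irrelevant. *)
Definition chart b z : R[i]^o :=
  match z, b with
  | Some x, Some c => (x - c)^-1
  | Some x, None => x
  | None, _ => 0
  end.

Definition ichart b (u : R[i]^o) : sphere R :=
  if b is Some c then (if u == 0 then infpt else finpt (c + u^-1))
  else finpt u.

Lemma chartK b z : z <> b -> ichart b (chart b z) = z.
Proof.
case: z b => [x|] [c|] //= xc; last by rewrite eqxx.
have [e|_] := eqVneq (x - c)^-1 0; last by rewrite invrK addrC subrK.
by case: xc; move/eqP: e; rewrite invr_eq0 subr_eq0 => /eqP ->.
Qed.

Lemma ichartK b : cancel (ichart b) (chart b).
Proof.
case: b => [c|] u //=; have [->|_] := eqVneq u 0 => //=.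
by rewrite addrC addKr invrK.
Qed.

Lemma ichart_neq b u : ichart b u <> b.
Proof.
case: b => [c|] //=; have [//|u0] := eqVneq u 0; case=> /eqP.
by rewrite -subr_eq0 addrC addKr invr_eq0 (negPf u0).
Qed.

Lemma nbhs_finpt (A : set (sphere R)) x :
  nbhs (finpt x) A = nbhs (x : R[i]^o) (@finpt R @^-1` A).
Proof. by []. Qed.

Lemma nbhs_infpt (A : set (sphere R)) :
  nbhs infpt A <-> A infpt /\ exists r, forall x, r < normc x -> A (finpt x).
Proof.
split.
  case=> C [/compact_normc_bounded[r Cr] _] CA; split; first by apply: CA; right.
  exists r => x rx; apply: CA; left; exists x => // /Cr.
  by rewrite leNgt rx.
case=> Ainf [r rA]; have [cD dD] := closed_disc_compact r.
exists [set z : R[i]^o | normc z <= r] => //.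
move=> z [[x /= rx <-]|-> //]; apply: rA.
by rewrite ltNge; exact/negP.
Qed.

Lemma ichart_continuous b : continuous (ichart b).
Proof.
case: b => [c|] u; last by move=> A.
have [->|u0] := eqVneq u 0.
  move=> A; rewrite /ichart eqxx => /nbhs_infpt[Ainf [r rA]].
  (* For y nonzero of modulus below the inverse of |r| + |c| + 1, the triangle inequality gives |c +
     1/y| >= |1/y| - |c| > r. *)
  apply/nbhs_normc; have r0 : 0 < `|r| + normc c + 1.
    by have := normr_ge0 r; have := normc_ge0 c; lra.
  exists (`|r| + normc c + 1)^-1; first by rewrite invr_gt0.
  move=> y; rewrite subr0 /=; have [//|y0 yr] := eqVneq y 0.
  apply: rA; rewrite -normc_gt0 in y0.
  have {}yr : `|r| + normc c + 1 < normc y^-1.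
    by rewrite normcV -[ltLHS]invrK ltf_pV2 // posrE ?invr_gt0.
  have := le_normcD (c + y^-1) (- c).
  by rewrite addrC addKr normcN; have := ler_norm r; lra.
have near0 : \forall v \near (u : R[i]^o), v != 0.
  apply/nbhs_normc; exists (normc u) => [|v]; first by rewrite normc_gt0.
  by apply: contraTneq => ->; rewrite sub0r normcN ltxx.
have h : (fun v : R[i]^o => (c + v^-1 : R[i]^o)) @ u --> (c + u^-1 : R[i]^o).
  apply: (@cvgD _ R[i]^o _ (nbhs u) _ (fun _ => c) (fun v => v^-1)).
    exact: cvg_cst.
  exact: (@cvgV R[i] _ (nbhs u) _ id u).
move=> A; rewrite [X in nbhs X]/= (negPf u0) => Ac.
have {}Ac : nbhs u [set v : R[i]^o | A (finpt (c + v^-1))] by exact: h Ac.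
by apply: filterS2 near0 Ac => v v0 Av; rewrite /= (negPf v0).
Qed.

Lemma chart_continuous b z : z <> b -> {for z, continuous (chart b)}.
Proof.
case: z b => [x|] [c|] xc; last by case: xc.
- move=> A Ac.
  suff: nbhs (x : R[i]^o) [set y : R[i]^o | A ((y - c)^-1)] by [].
  have h : (fun y : R[i]^o => (y - c : R[i]^o)) @ x --> (x - c : R[i]^o).
    apply: (@cvgB _ R[i]^o _ (nbhs (x : R[i]^o)) _ id (fun _ => c)) => //.
    exact: cvg_cst.
  apply: (@cvgV R[i] _ (nbhs (x : R[i]^o)) _ (fun y => y - c) _ _ h A Ac).
  by rewrite subr_eq0; apply: contra_not_neq xc => ->.
- by move=> A.
- move=> A /nbhs_normc[e e0 eA]; apply/nbhs_infpt; split.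
    by apply: eA; rewrite subrr normc0.
  exists (e^-1 + normc c) => y yc; apply: eA => /=.
  have h : e^-1 < normc (y - c).
    by have := le_normcD (y - c) c; rewrite subrK; lra.
  rewrite subr0 normcV -[ltRHS]invrK ltf_pV2 // posrE ?invr_gt0 //.
  by apply: lt_trans h; rewrite invr_gt0.
Qed.

End Charts.

(** * The anharmonic ratio *)

Section Anharmonic.
Variable R : realType.
Implicit Types (s z w : sphere R) (T W : quad R) (l : seq (sphere R)).

(* Homogeneous coordinates, in which [infpt] is (1 : 0). *)
Definition hx z : R[i] := if z is Some x then x else 1.
Definition hy z : R[i] := if z is Some _ then 1 else 0.

Definition bracket z w : R[i] := hx z * hy w - hx w * hy z.

Definition cross_num T : R[i] :=
  let: (z1, z2, z3, z4) := T in bracket z1 z3 * bracket z2 z4.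

Definition cross_den T : R[i] :=
  let: (z1, z2, z3, z4) := T in bracket z3 z2 * bracket z4 z1.

Lemma bracket_eq0 z w : (bracket z w == 0) = (z == w).
Proof.
case: z w => [x|] [y|]; rewrite /bracket /=.
- by rewrite !mulr1 subr_eq0.
- by rewrite mulr0 mul1r sub0r oppr_eq0 oner_eq0.
- by rewrite mulr0 mul1r subr0 oner_eq0.
- by rewrite !mulr0 subrr !eqxx.
Qed.

(* The Pluecker relation. *)
Lemma cross_numBden z1 z2 z3 z4 :
  cross_num (z1, z2, z3, z4) - cross_den (z1, z2, z3, z4) =
  bracket z1 z2 * bracket z4 z3 * -1.
Proof. by rewrite /cross_num /cross_den /bracket; ring. Qed.

(** A factor of the numerator and a factor of the denominator share exactly one point, so if both
    vanish three points coincide. Thus 0/0 never occurs for a tetrad. *)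
Lemma tetrad_cross_num T : tetrad T -> cross_den T = 0 -> cross_num T != 0.
Proof.
case: T => [[[z1 z2] z3] z4] [h1 h2 h3 h4] /= /eqP.
rewrite !mulf_eq0 !bracket_eq0 => h; apply/negP => /orP h'.
case/orP: h => /eqP e; case: h' => /eqP e'; subst;
  [apply: h1|apply: h4|apply: h3|apply: h2]; by split.
Qed.

Lemma nonsingularP z1 z2 z3 z4 : nonsingular (z1, z2, z3, z4) <->
  [/\ z1 <> z2, z1 <> z3, z1 <> z4 & [/\ z2 <> z3, z2 <> z4 & z3 <> z4]].
Proof.
rewrite /nonsingular /= !inE !negb_or !andbT -!andbA; split.
  by case/and5P => ? ? ? ? /andP[? ?]; split; try split; apply/eqP.
by case=> ? ? ? [? ? ?]; do !(apply/andP; split); apply/eqP.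
Qed.

Lemma nonsingular_tetrad T : nonsingular T -> tetrad T.
Proof.
case: T => [[[z1 z2] z3] z4] /nonsingularP[h12 h13 h14 [h23 h24 h34]].
by split => -[].
Qed.

Lemma nonsingular_cross_den T : nonsingular T -> cross_den T != 0.
Proof.
case: T => [[[z1 z2] z3] z4] /nonsingularP[h12 h13 h14 [h23 h24 h34]] /=.
by rewrite mulf_eq0 !bracket_eq0; apply/norP; split; apply/eqP => ?; congruence.
Qed.

Lemma nonsingular_cross_num T : nonsingular T -> cross_num T != 0.
Proof.
case: T => [[[z1 z2] z3] z4] /nonsingularP[h12 h13 h14 [h23 h24 h34]] /=.
by rewrite mulf_eq0 !bracket_eq0; apply/norP; split; apply/eqP => ?; congruence.
Qed.

(** The sphere has no isolated points: a chart provides an injective sequence inside [A], and a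
    finite list cannot contain all of it. *)
Lemma nbhs_avoid s (A : set (sphere R)) l :
  nbhs s A -> exists2 w, A w & w \notin l.
Proof.
move=> As; pose b : sphere R := if s is Some x then infpt else finpt 0.
have bs : s <> b by rewrite /b; case: (s).
have : nbhs (chart b s) (ichart b @^-1` A).
  by apply: ichart_continuous; rewrite chartK.
move=> /nbhs_normc[e e0 eA].
(* The shift [k.+2] keeps the offset strictly below [e] already for k = 0. *)
pose g (k : nat) := ichart b (chart b s + (e / k.+2%:R)%:C).
have gA k : A (g k).
  apply: eA; rewrite addrC addKr normc_real ger0_norm ?divr_ge0 ?ltW//.
  by rewrite ltr_pdivrMr ?ltr0n // -[ltLHS]mulr1 ltr_pM2l ?ltr1n.
have g_inj : injective g.
  move=> j k /(can_inj (@ichartK _ _))/addrI/complexI/(mulfI (lt0r_neq0 e0)).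
  by move/invr_inj/eqP; rewrite eqr_nat => /eqP[].
apply: contrapT => h.
have sub : {subset [seq g k | k <- iota 0 (size l).+1] <= l}.
  move=> _ /mapP[k _ ->]; apply/negPn/negP => gk.
  by apply: h; exists (g k).
have := uniq_leq_size _ sub; rewrite map_inj_uniq // iota_uniq.
by rewrite size_map size_iota ltnn => /(_ isT).
Qed.

Definition finite_nonsingular : set (quad R) :=
  [set W | nonsingular W /\ quad_in (range (@finpt R)) W].

(** Needed for limits along this filter to be unique. The four coordinates are picked one after
    another, each avoiding infinity and the points already chosen. *)
Lemma within_finite_nonsingular_proper T :
  ProperFilter (within finite_nonsingular (nbhs T)).
Proof.
apply: Build_ProperFilter_ex => A.
case: T => [[[z1 z2] z3] z4].
case=> -[A123 A4] /= [[[A12 A3] /= [[[A1 A2] /= [h1 h2] s2] h3] s3] h4] s4.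
have [w1 A1w n1] := nbhs_avoid [:: infpt] h1.
have [w2 A2w n2] := nbhs_avoid [:: infpt; w1] h2.
have [w3 A3w n3] := nbhs_avoid [:: infpt; w1; w2] h3.
have [w4 A4w n4] := nbhs_avoid [:: infpt; w1; w2; w3] h4.
exists (w1, w2, w3, w4); apply: (s4 (w1, w2, w3, w4)).
  split => //; apply: (s3 (w1, w2, w3)); split => //.
  exact: (s2 (w1, w2)).
rewrite !inE ?negb_or in n1 n2 n3 n4; case/and3P: n3 => n30 n31 n32.
case/andP: n2 => n20 n21; case/and4P: n4 => n40 n41 n42 n43.
split.
  by apply/nonsingularP; split; last split; apply/eqP; rewrite // eq_sym.
have fin w : w != infpt -> range (@finpt R) w by case: w => [x|//] _; exists x.
by split; exact: fin.
Qed.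

(* Near [s], the homogeneous coordinates can be rescaled to be continuous. *)
Lemma continuous_coordinates s : exists n d : sphere R -> R[i]^o,
  [/\ {for s, continuous n}, {for s, continuous d}, n s = hx s, d s = hy s &
    \forall w \near s, forall x, w = finpt x -> n w = x * d w /\ d w != 0].
Proof.
have cst1 (t : sphere R) : {for t, continuous (fun _ : sphere R => 1 : R[i]^o)}.
  move=> A /nbhs_singleton A1.
  by apply: (@filterS _ _ (nbhs_filter t) setT _ _ (@filterT _ _ (nbhs_filter t))).
case: s => [x|].
  exists (chart infpt), (fun=> 1); split; [|exact: cst1|by []|by []|].
    exact: (@chart_continuous R infpt (finpt x)).
  apply: (@filterS _ _ (nbhs_filter (finpt x)) setT _ _
    (@filterT _ _ (nbhs_filter (finpt x)))) => w _ y ->.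
  by rewrite mulr1 oner_eq0.
exists (fun=> 1), (chart (finpt 0)); split; [exact: cst1| |by []|by []|].
  exact: (@chart_continuous R (finpt 0) infpt).
apply/nbhs_infpt; split => //; exists 0 => y; rewrite normc_gt0 => y0 _ [<-].
by rewrite /= subr0 mulfV // invr_eq0.
Qed.

End Anharmonic.

(** * Evaluation of the limit that defines the anharmonic ratio *)

Section AnharmonicValue.
Variable R : realType.
Implicit Types (s z w : sphere R) (T W : quad R).

Lemma quad_proj_cvg (z1 z2 z3 z4 : sphere R) :
  let T : quad R := (z1, z2, z3, z4) in
  [/\ (fun W : quad R => W.1.1.1) @ nbhs T --> z1,
      (fun W : quad R => W.1.1.2) @ nbhs T --> z2,
      (fun W : quad R => W.1.2) @ nbhs T --> z3 &
      (fun W : quad R => W.2) @ nbhs T --> z4].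
Proof.
move=> T.
have f4 : (fun W : quad R => W.2) @ nbhs T --> z4 by exact: cvg_snd.
have f0 : (fun W : quad R => W.1) @ nbhs T --> (z1, z2, z3) by exact: cvg_fst.
have f3 : (fun W : quad R => W.1.2) @ nbhs T --> z3.
  by apply: (cvg_comp _ _ f0); exact: cvg_snd.
have f1 : (fun W : quad R => W.1.1) @ nbhs T --> (z1, z2).
  by apply: (cvg_comp _ _ f0); exact: cvg_fst.
split => //.
  by apply: (cvg_comp _ _ f1); exact: cvg_fst.
by apply: (cvg_comp _ _ f1); exact: cvg_snd.
Qed.

(** Each point occurs once in the numerator and once in the denominator, so rescaling its
    homogeneous coordinates by e_i multiplies both by the same factor. *)
Lemma cross_ratio_rescale (x1 x2 x3 x4 e1 e2 e3 e4 : R[i])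
  (N := (x1 * e1 * e3 - x3 * e3 * e1) * (x2 * e2 * e4 - x4 * e4 * e2))
  (D := (x3 * e3 * e2 - x2 * e2 * e3) * (x4 * e4 * e1 - x1 * e1 * e4)) :
  e1 != 0 -> e2 != 0 -> e3 != 0 -> e4 != 0 ->
  (x1 - x3) * (x2 - x4) != 0 -> (x3 - x2) * (x4 - x1) != 0 ->
  [/\ finpt ((x1 - x3) * (x2 - x4) / ((x3 - x2) * (x4 - x1))) = finpt (N / D),
    N != 0 & D != 0].
Proof.
move=> h1 h2 h3 h4 Nn Dn; pose k := e1 * e2 * e3 * e4.
have k0 : k != 0 by rewrite !mulf_neq0.
have -> : N = (x1 - x3) * (x2 - x4) * k by rewrite /N /k; ring.
have -> : D = (x3 - x2) * (x4 - x1) * k by rewrite /D /k; ring.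
split; [congr finpt|exact: mulf_neq0|exact: mulf_neq0].
by rewrite (invfM _ k) [RHS]mulrACA divff // mulr1.
Qed.

(** In rescaled continuous coordinates the numerator and the denominator converge separately, to
    [cross_num T] and [cross_den T], and these are not both zero. *)
Lemma cross_ratio_cvg T :
  tetrad T -> @cross_ratio R @ within (@finite_nonsingular R) (nbhs T) -->
    (if cross_den T == 0 then infpt else finpt (cross_num T / cross_den T)).
Proof.
case: T => [[[z1 z2] z3] z4]; set T : quad R := (z1, z2, z3, z4) => tT.
set F := within _ _.
have FF : ProperFilter F := within_finite_nonsingular_proper T.
have FT : @Filter (quad R) (nbhs T) := nbhs_filter T.
have [p1 p2 p3 p4] := quad_proj_cvg z1 z2 z3 z4.
have [n1 [d1 [cn1 cd1 en1 ed1 r1]]] := continuous_coordinates z1.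
have [n2 [d2 [cn2 cd2 en2 ed2 r2]]] := continuous_coordinates z2.
have [n3 [d3 [cn3 cd3 en3 ed3 r3]]] := continuous_coordinates z3.
have [n4 [d4 [cn4 cd4 en4 ed4 r4]]] := continuous_coordinates z4.
have toF (g : quad R -> R[i]^o) (l : R[i]^o) : g @ nbhs T --> l -> g @ F --> l.
  by move=> gl; apply: cvg_trans gl; apply: cvg_app; exact: cvg_within.
have m1 := toF _ _ (cvg_comp _ _ p1 cn1); have m1' := toF _ _ (cvg_comp _ _ p1 cd1).
have m2 := toF _ _ (cvg_comp _ _ p2 cn2); have m2' := toF _ _ (cvg_comp _ _ p2 cd2).
have m3 := toF _ _ (cvg_comp _ _ p3 cn3); have m3' := toF _ _ (cvg_comp _ _ p3 cd3).
have m4 := toF _ _ (cvg_comp _ _ p4 cn4); have m4' := toF _ _ (cvg_comp _ _ p4 cd4).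
rewrite en1 in m1; rewrite ed1 in m1'.
rewrite en2 in m2; rewrite ed2 in m2'.
rewrite en3 in m3; rewrite ed3 in m3'.
rewrite en4 in m4; rewrite ed4 in m4'.
have cM (a b : quad R -> R[i]^o) (u v : R[i]^o) :
    a @ F --> u -> b @ F --> v ->
    (fun W => a W * b W : R[i]^o) @ F --> (u * v : R[i]^o).
  by move=> au bv; exact: (@cvgM R[i] _ F _ a b u v au bv).
have cV (a : quad R -> R[i]^o) (u : R[i]) :
    u != 0 -> a @ F --> (u : R[i]^o) ->
    (fun W => (a W)^-1 : R[i]^o) @ F --> (u^-1 : R[i]^o).
  by move=> u0 au; exact: (@cvgV R[i] _ F _ a u u0 au).
have cB (a b c d : quad R -> R[i]^o) (u v w x : R[i]^o) :
    a @ F --> u -> b @ F --> v -> c @ F --> w -> d @ F --> x ->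
    (fun W => a W * b W - c W * d W : R[i]^o) @ F --> (u * v - w * x : R[i]^o).
  move=> au bv cw dx.
  exact: (@cvgB _ R[i]^o _ F _ _ _ _ _ (cM _ _ _ _ au bv) (cM _ _ _ _ cw dx)).
have b13 := cB _ _ _ _ _ _ _ _ m1 m3' m3 m1'.
have b24 := cB _ _ _ _ _ _ _ _ m2 m4' m4 m2'.
have b32 := cB _ _ _ _ _ _ _ _ m3 m2' m2 m3'.
have b41 := cB _ _ _ _ _ _ _ _ m4 m1' m1 m4'.
have cN := cM _ _ _ _ b13 b24.
have cD := cM _ _ _ _ b32 b41.
set N := (X in X @ F --> _) in cN; set D := (X in X @ F --> _) in cD.
have cr : F [set W | [/\ cross_ratio W = finpt (N W / D W), N W != 0 & D W != 0]].
  have near_proj (g : quad R -> sphere R) z (A : set (sphere R)) :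
      g @ nbhs T --> z -> nbhs z A -> nbhs T (g @^-1` A) by exact.
  have e1 := near_proj _ _ _ p1 r1; have e2 := near_proj _ _ _ p2 r2.
  have e3 := near_proj _ _ _ p3 r3; have e4 := near_proj _ _ _ p4 r4.
  have e5 := @filterI _ _ FT _ _ (@filterI _ _ FT _ _ e1 e2)
    (@filterI _ _ FT _ _ e3 e4).
  suff: nbhs T [set W | finite_nonsingular W ->
    [/\ cross_ratio W = finpt (N W / D W), N W != 0 & D W != 0]] by [].
  refine (@filterS _ _ FT _ _ _ e5) => W [[h1 h2] [h3 h4]] [nW finW].
  have Nn : cross_num W != 0 by exact: nonsingular_cross_num.
  have Dn := nonsingular_cross_den nW.
  move: h1 h2 h3 h4 finW Nn Dn; rewrite /N /D /=.
  case: W nW => [[[w1 w2] w3] w4] nW /= h1 h2 h3 h4.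
  case=> -[x1 _ e1'] [x2 _ e2'] [x3 _ e3'] [x4 _ e4']; subst w1 w2 w3 w4.
  have [-> nz1] := h1 _ erefl; have [-> nz2] := h2 _ erefl.
  have [-> nz3] := h3 _ erefl; have [-> nz4] := h4 _ erefl.
  rewrite /bracket /= !mulr1 => Nn Dn.
  exact: (cross_ratio_rescale nz1 nz2 nz3 nz4 Nn Dn).
(* If the limit of the denominator is 0, the reciprocal quotient tends to 0; the continuous map
   [ichart (finpt 0)], which is u -> 1/u with 0 sent to infinity, turns this into convergence to
   [infpt]. *)
have [D0|D0] := eqVneq (cross_den T) 0.
  have N0 : cross_num T != 0 by exact: tetrad_cross_num.
  have cNV := cV N (cross_num T) N0 cN.
  have c0 : (fun W => D W / N W : R[i]^o) @ F --> (0 : R[i]^o).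
    have h := cM D (fun W => (N W)^-1) (cross_den T) (cross_num T)^-1 cD cNV.
    by rewrite D0 mul0r in h.
  have := cvg_comp _ _ c0 (@ichart_continuous R (finpt 0) 0).
  rewrite /= eqxx; apply: cvg_trans; apply: near_eq_cvg.
  apply: filterS cr => W [-> NW DW] /=.
  by rewrite mulf_eq0 invr_eq0 (negPf NW) (negPf DW) /= add0r invf_div.
have c0 : (fun W => N W / D W : R[i]^o) @ F --> (cross_num T / cross_den T : R[i]^o).
  have cDV := cV D (cross_den T) D0 cD.
  exact: (cM N (fun W => (D W)^-1) (cross_num T) (cross_den T)^-1 cN cDV).
have := cvg_comp _ _ c0 (@ichart_continuous R infpt _).
apply: cvg_trans; apply: near_eq_cvg.
by apply: filterS cr => W [-> _ _].
Qed.

Lemma anharmonicE T : tetrad T -> anharmonic T =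
  if cross_den T == 0 then infpt else finpt (cross_num T / cross_den T).
Proof.
move=> /cross_ratio_cvg cT; rewrite /anharmonic.
have FF := within_finite_nonsingular_proper T.
exact: (@cvg_lim _ (@sphere_hausdorff R) _ _ FF _ _ cT).
Qed.

End AnharmonicValue.

(** * Linear-fractional functions *)

Section LinFrac.
Variable R : realType.
Implicit Types (z w : sphere R) (T : quad R) (a b c d : R[i]).

(** The factor between the normalized coordinates ([hx], [hy]) of the image and the matrix applied
    to those of [z]. *)
Definition lin_frac_scale a b c d z : R[i] :=
  match z with
  | Some x => if c * x + d == 0 then (a * x + b)^-1 else (c * x + d)^-1
  | None => if c == 0 then a^-1 else c^-1
  end.

Lemma lin_frac_coordinates a b c d z : a * d - b * c != 0 ->
  [/\ hx (lin_frac a b c d z) =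
        lin_frac_scale a b c d z * (a * hx z + b * hy z),
      hy (lin_frac a b c d z) =
        lin_frac_scale a b c d z * (c * hx z + d * hy z) &
      lin_frac_scale a b c d z != 0].
Proof.
move=> det; case: z => [x|] /=; rewrite ?mulr1 ?mulr0 ?addr0.
  have [e|e] := eqVneq (c * x + d) 0.
    have n0 : a * x + b != 0.
      apply: contraNneq det => e'.
      have [c0|c0] := eqVneq c 0.
        move: e; rewrite c0 mul0r add0r => ->.
        by rewrite !mulr0 subrr.
      apply/eqP/(mulIf c0); rewrite mul0r.
      have -> : (a * d - b * c) * c =
        c * (a * (c * x + d) - c * (a * x + b)) by ring.
      by rewrite e e' !mulr0 subrr mulr0.
    by rewrite /= e mulVf // mulr0 invr_eq0.
  by rewrite /= mulVf // mulrC invr_eq0.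
have [c0|c0] := eqVneq c 0 => /=.
  have a0 : a != 0 by apply: contraNneq det => ->; rewrite c0 mulr0 mul0r subrr.
  by rewrite c0 mulr0 mulVf // invr_eq0.
by rewrite mulVf // mulrC invr_eq0.
Qed.

(** The bracket is the determinant of two coordinate vectors, so it picks up the determinant of the
    matrix and the two normalizing factors. *)
Lemma bracket_lin_frac a b c d z w : a * d - b * c != 0 ->
  bracket (lin_frac a b c d z) (lin_frac a b c d w) =
  (a * d - b * c) * lin_frac_scale a b c d z * lin_frac_scale a b c d w
  * bracket z w.
Proof.
move=> det; have [hz hz' _] := lin_frac_coordinates z det.
have [hw hw' _] := lin_frac_coordinates w det.
by rewrite /bracket hz hz' hw hw'; ring.
Qed.

Lemma lin_frac_inj a b c d : a * d - b * c != 0 ->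
  injective (lin_frac a b c d : sphere R -> sphere R).
Proof.
move=> det z w e; have := bracket_lin_frac z w det.
have [_ _ kz] := lin_frac_coordinates z det.
have [_ _ kw] := lin_frac_coordinates w det.
move/eqP: e; rewrite -bracket_eq0 => /eqP -> /eqP.
by rewrite eq_sym !mulf_eq0 (negPf det) (negPf kz) (negPf kw) /= bracket_eq0 => /eqP.
Qed.

Lemma lin_frac_comp a b c d a' b' c' d' :
  a * d - b * c != 0 -> a' * d' - b' * c' != 0 ->
  lin_frac a b c d \o lin_frac a' b' c' d' =
  lin_frac (a * a' + b * c') (a * b' + b * d') (c * a' + d * c')
    (c * b' + d * d') :> (sphere R -> sphere R).
Proof.
move=> det det'; apply/funext => z /=; apply/eqP; rewrite -bracket_eq0; apply/eqP.
have det2 : (a * a' + b * c') * (c * b' + d * d') -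
    (a * b' + b * d') * (c * a' + d * c') != 0.
  rewrite (_ : _ - _ = (a * d - b * c) * (a' * d' - b' * c')); last by ring.
  exact: mulf_neq0.
have [h1 h2 _] := lin_frac_coordinates z det'.
have [h3 h4 _] := lin_frac_coordinates (lin_frac a' b' c' d' z) det.
have [h5 h6 _] := lin_frac_coordinates z det2.
by rewrite /bracket h3 h4 h5 h6 h1 h2; ring.
Qed.

Lemma is_lin_frac_comp (g h : sphere R -> sphere R) :
  is_lin_frac g -> is_lin_frac h -> is_lin_frac (g \o h).
Proof.
move=> [a [b [c [d [det ->]]]]] [a' [b' [c' [d' [det' ->]]]]].
exists (a * a' + b * c'), (a * b' + b * d'), (c * a' + d * c'), (c * b' + d * d').
rewrite lin_frac_comp //; split => //.
rewrite (_ : _ - _ = (a * d - b * c) * (a' * d' - b' * c')); last by ring.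
exact: mulf_neq0.
Qed.

(** A polynomial form of having anharmonic ratio [a], free of limits and divisions; the two notions
    agree on tetrads when [a] is neither 0 nor 1. *)
Definition cross_eq a T := nonsingular T /\ cross_num T = a * cross_den T.

(** Since [a] is neither 0 nor 1, the numerator, the denominator and their difference are all
    nonzero. By the Pluecker relation their factors are the brackets of all six pairs, so the points
    are pairwise different. *)
Lemma cross_eqI a T : a != 0 -> a != 1 -> cross_den T != 0 ->
  cross_num T = a * cross_den T -> cross_eq a T.
Proof.
move=> a0 a1 D0 eq; split=> //.
have N0 : cross_num T != 0 by rewrite eq mulf_neq0.
have ND : cross_num T - cross_den T != 0.
  by rewrite eq -[X in _ - X]mul1r -mulrBl mulf_neq0 // subr_eq0.
case: T N0 ND D0 {eq} => [[[z1 z2] z3] z4].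
rewrite cross_numBden /cross_num /cross_den !mulf_eq0 !bracket_eq0 !negb_or.
case/andP=> /eqP h13 /eqP h24 /andP[/andP[/eqP h12 /eqP h43] _].
case/andP=> /eqP h32 /eqP h41.
by apply/nonsingularP; split; [| | |split]; congruence.
Qed.

Lemma tetrad_cross_eq a T : a != 0 -> a != 1 -> tetrad T ->
  anharmonic T = finpt a -> cross_eq a T.
Proof.
move=> a0 a1 tT; rewrite anharmonicE //.
have [//|D0 [e]] := eqVneq (cross_den T) 0.
by apply: cross_eqI; rewrite // -e divfK.
Qed.

(** Cross-multiplying the two equations eliminates the ratio; by the Pluecker relation what remains
    is the bracket of [z4] and [z4'] times nonzero factors. *)
Lemma cross_eq_unique a z1 z2 z3 z4 z4' : a != 0 ->
  cross_eq a (z1, z2, z3, z4) -> cross_eq a (z1, z2, z3, z4') -> z4 = z4'.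
Proof.
move=> a0 [n e] [_ e'].
have /= := nonsingular_cross_num n; have /= := nonsingular_cross_den n.
case/nonsingularP: n => /eqP h12 _ _ _; move: e e'; rewrite /cross_num /cross_den.
rewrite !mulf_eq0 !negb_or => e e' /andP[d32 d41] /andP[n13 n24].
apply/eqP; rewrite -bracket_eq0.
suff : a * bracket z3 z2 * bracket z1 z3 * bracket z1 z2 * bracket z4 z4' == 0.
  rewrite !mulf_eq0 bracket_eq0 (negPf a0) (negPf d32) (negPf n13).
  by rewrite bracket_eq0 (negPf h12).
apply/eqP; transitivity
  ((a * (bracket z3 z2 * bracket z4' z1)) * (bracket z1 z3 * bracket z2 z4) -
   (a * (bracket z3 z2 * bracket z4 z1)) * (bracket z1 z3 * bracket z2 z4')).
  by rewrite /bracket; ring.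
by rewrite -e -e'; ring.
Qed.

Lemma cross_eq_anharmonic a T : cross_eq a T -> anharmonic T = finpt a.
Proof.
move=> [nT e]; rewrite anharmonicE; last exact: nonsingular_tetrad.
by rewrite (negPf (nonsingular_cross_den nT)) e mulfK // nonsingular_cross_den.
Qed.

Lemma cross_eq_lin_frac g a T : is_lin_frac g ->
  cross_eq a T -> cross_eq a (quad_map g T).
Proof.
move=> [p [q [r [s [det ->]]]]]; case: T => [[[z1 z2] z3] z4] [/nonsingularP nT e].
have inj := @lin_frac_inj _ _ _ _ det.
split.
  case: nT => h12 h13 h14 [h23 h24 h34].
  by apply/nonsingularP; split; [| | |split] => /inj.
move: e; rewrite /cross_num /cross_den /= !bracket_lin_frac // => e.
set D := _ - _; set k1 := lin_frac_scale _ _ _ _ z1.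
set k2 := lin_frac_scale _ _ _ _ z2; set k3 := lin_frac_scale _ _ _ _ z3.
set k4 := lin_frac_scale _ _ _ _ z4.
transitivity (D ^+ 2 * k1 * k2 * k3 * k4 * (bracket z1 z3 * bracket z2 z4)).
  by ring.
by rewrite e; ring.
Qed.

Definition preserves_cross a (U : set (sphere R)) (f : sphere R -> sphere R) :=
  forall T, quad_in U T -> cross_eq a T -> tetrad (quad_map f T) ->
    cross_eq a (quad_map f T).

Lemma phi_preserves_cross a U f : a != 0 -> a != 1 ->
  phi_cond (finpt a) U f -> preserves_cross a U f.
Proof.
move=> a0 a1 phi T TU eT tfT; apply: tetrad_cross_eq => //.
apply: phi => //; first by apply: nonsingular_tetrad; case: eT.
exact: cross_eq_anharmonic.
Qed.

Lemma tetrad_of_map (g : sphere R -> sphere R) T :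
  tetrad (quad_map g T) -> tetrad T.
Proof.
case: T => [[[z1 z2] z3] z4] /= [h1 h2 h3 h4].
by split=> -[e e']; [case: h1|case: h2|case: h3|case: h4]; rewrite e e'.
Qed.

Lemma preserves_cross_lin_frac a U f (g h : sphere R -> sphere R) :
  is_lin_frac g -> is_lin_frac h -> preserves_cross a U f ->
  preserves_cross a (g @^-1` U) (h \o f \o g).
Proof.
move=> lg lh pf T TU eT tT.
have E : quad_map (h \o f \o g) T = quad_map h (quad_map f (quad_map g T)).
  by case: (T) => [[[? ?] ?] ?].
rewrite E; apply: cross_eq_lin_frac => //; apply: pf.
- by case: T TU {eT tT E} => [[[? ?] ?] ?].
- exact: cross_eq_lin_frac.
- by move: tT; rewrite E; exact: tetrad_of_map.
Qed.

(* [to_inf b] extends [chart b] to the sphere by [b |-> infpt], and [of_inf b]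
   is its inverse. *)
Definition to_inf (p : sphere R) : sphere R -> sphere R :=
  if p is Some c then lin_frac 0 1 1 (- c) else lin_frac 1 0 0 1.

Definition of_inf (p : sphere R) : sphere R -> sphere R :=
  if p is Some c then lin_frac c 1 1 0 else lin_frac 1 0 0 1.

Lemma is_lin_frac_to_inf p : is_lin_frac (to_inf p).
Proof.
case: p => [c|]; [exists 0, 1, 1, (- c)|exists 1, 0, 0, 1]; split=> //;
  by rewrite ?mul0r ?mulr1 ?mulr0 ?sub0r ?subr0 ?oppr_eq0 oner_eq0.
Qed.

Lemma is_lin_frac_of_inf p : is_lin_frac (of_inf p).
Proof.
case: p => [c|]; [exists c, 1, 1, 0|exists 1, 0, 0, 1]; split=> //;
  by rewrite ?mul0r ?mulr1 ?mulr0 ?sub0r ?subr0 ?oppr_eq0 oner_eq0.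
Qed.

Lemma to_inf_self p : to_inf p p = infpt.
Proof. by case: p => [c|] /=; rewrite ?mul1r ?subrr eqxx. Qed.

Lemma of_inf_infpt p : of_inf p infpt = p.
Proof. by case: p => [c|] /=; rewrite ?oner_eq0 ?divr1 ?eqxx. Qed.

Lemma of_inf_finpt p (u : R[i]) : of_inf p (finpt u) = ichart p u.
Proof.
case: p => [c|] /=; last first.
  by rewrite mul0r add0r oner_eq0 mul1r addr0 divr1.
rewrite mul1r addr0; have [//|u0] := eqVneq u 0.
by congr finpt; rewrite mulrDl mulfK // mul1r.
Qed.

Lemma to_inf_neq p z : z <> p -> to_inf p z = finpt (chart p z).
Proof.
case: p z => [c|] [x|] //= xc.
- rewrite mul1r mul0r add0r; case: eqVneq => [/eqP|_]; last by rewrite mul1r.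
  by rewrite subr_eq0 => /eqP e; case: xc; rewrite e.
- by rewrite oner_eq0 mul0r.
- by rewrite mul0r add0r oner_eq0 mul1r addr0 divr1.
Qed.

Lemma to_infK p : cancel (to_inf p) (of_inf p).
Proof.
move=> z; have [->|/eqP zp] := eqVneq z p; first by rewrite to_inf_self of_inf_infpt.
by rewrite to_inf_neq // of_inf_finpt chartK.
Qed.

Lemma of_infK p : cancel (of_inf p) (to_inf p).
Proof.
case=> [u|]; last by rewrite of_inf_infpt to_inf_self.
by rewrite -/(finpt u) of_inf_finpt to_inf_neq ?ichartK //; exact: ichart_neq.
Qed.

(** True also at z = p, where both sides take the default value 0. *)
Lemma chart_to_inf p z : chart infpt (to_inf p z) = chart p z.
Proof.
have [->|/eqP zp] := eqVneq z p; last by rewrite to_inf_neq.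
by rewrite to_inf_self; case: p => [c|] //=; rewrite subrr invr0.
Qed.

End LinFrac.

(** * Discs of points with a finite image *)

Section Growth.
Variable R : realType.
Implicit Types (x y z c a : R[i]) (r rho : R).

Lemma bernoulli (k : R) n : 1 <= k -> 1 + n%:R * (k - 1) <= k ^+ n.
Proof.
move=> k1; elim: n => [|n IHn]; first by rewrite mul0r addr0 expr0.
have h : k ^+ n <= k ^+ n * k by rewrite ler_peMr // exprn_ge0 //; lra.
have h1 : 1 <= k ^+ n by rewrite exprn_ege1.
rewrite exprSr -natr1; nra.
Qed.

(** With k = |l| + |1 - l| > 1, a point at distance t from [c] is the combination, with weights 1 -
    l and l, of two points at distance t/k. So the radius of a disc inside [O] can be multiplied by
    k until it reaches [rho]. *)
Lemma ball_growth (l : R[i]) (O : set R[i]) c rho r :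
  1 < normc l + normc (1 - l) -> l != 0 -> l != 1 -> 0 < r ->
  (forall u, normc (u - c) < r -> O u) ->
  (forall x y, x <> y -> O x -> O y ->
     normc ((1 - l) * x + l * y - c) < rho -> O ((1 - l) * x + l * y)) ->
  forall u, normc (u - c) < rho -> O u.
Proof.
set k := normc l + normc (1 - l) => k1 l0 l1 r0 Or Ol.
have l1' : 1 - l != 0 by rewrite subr_eq0 eq_sym.
have k0 : 0 < k by lra.
have kn0 : k%:C != 0 :> R[i] by rewrite -normc_gt0 normc_real normr_gt0 gt_eqF.
have step n : forall u, normc (u - c) < k ^+ n * r -> normc (u - c) < rho -> O u.
  elim: n => [|n IHn] u; first by rewrite expr0 mul1r => /Or.
  set d := u - c => d1 d2.
  have [d0|d0] := eqVneq d 0.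
    by apply: Or; rewrite -/d d0 normc0.
  (* The offsets are rotated so that (1 - l)(x - c) and l(y - c) are positive multiples of [d],
     namely |1 - l|/k and |l|/k times [d], which add up to [d]. *)
  pose x := c + d * ((normc (1 - l))%:C / ((1 - l) * k%:C)).
  pose y := c + d * ((normc l)%:C / (l * k%:C)).
  have nx : normc (x - c) = normc d / k.
    rewrite /x addrC addKr !normcM normcV normcM !normc_real.
    rewrite !ger0_norm ?normc_ge0 ?ltW //; field.
    by rewrite !gt_eqF // normc_gt0.
  have ny : normc (y - c) = normc d / k.
    rewrite /y addrC addKr !normcM normcV normcM !normc_real.
    rewrite !ger0_norm ?normc_ge0 ?ltW //; field.
    by rewrite !gt_eqF // normc_gt0.
  have nd : 0 < normc d by rewrite normc_gt0.
  have dk : normc d / k < normc d by rewrite ltr_pdivrMr // ltr_pMr.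
  have dkn : normc d / k < k ^+ n * r by rewrite ltr_pdivrMr // mulrAC -exprSr.
  have E : u = (1 - l) * x + l * y.
    have kE : k%:C = (normc (1 - l))%:C + (normc l)%:C by rewrite -rmorphD addrC.
    have {1}-> : u = c + d * (k%:C / k%:C) by rewrite divff // mulr1 /d addrC subrK.
    by rewrite {1}kE /x /y; field; rewrite kn0 l0 l1'.
  rewrite E; apply: Ol; [move=> xy|..].
  - move: nx; rewrite (_ : x = u); last by rewrite E -xy; ring.
    by rewrite -/d => ndk; move: dk; rewrite -ndk ltxx.
  - by apply: IHn; rewrite nx //; exact: lt_trans d2.
  - by apply: IHn; rewrite ny //; exact: lt_trans d2.
  - by rewrite -E.
move=> u urho; have kr : 0 < (k - 1) * r by rewrite mulr_gt0 // subr_gt0.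
(* By the Archimedean property n (k - 1) r exceeds [rho], and Bernoulli's inequality then gives k^n
   r > rho. *)
apply: (step (Num.bound `|rho / ((k - 1) * r)|)) => //.
set n := Num.bound _; have := archi_boundP (normr_ge0 (rho / ((k - 1) * r))).
rewrite -/n.
move/(le_lt_trans (ler_norm _)); rewrite ltr_pdivrMr // => h.
apply: (lt_le_trans urho); apply: (le_trans (ltW h)).
have := bernoulli n (ltW k1); rewrite -(ler_pM2r r0); nra.
Qed.

(** Equality in the triangle inequality for l + (1 - l) = 1 makes both terms nonnegative multiples
    of a common unit [t], and their sum forces t = 1. *)
Lemma normc_sum_le1 (l : R[i]) : normc l + normc (1 - l) <= 1 ->
  l = (normc l)%:C.
Proof.
move=> h; have e : `|l + (1 - l)| = `|l| + `|1 - l|.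
  rewrite addrC subrK normr1 !normc_norm -rmorphD; congr (_%:C).
  have := le_normcD l (1 - l); rewrite addrC subrK normc1; lra.
have [t _ [e1 e2]] := normCDeq e.
have t1 : t = 1.
  have : (`|l| + `|1 - l|) * t = 1 by rewrite mulrDl -e1 -e2 addrC subrK.
  by rewrite -e addrC subrK normr1 mul1r.
by rewrite e1 t1 mulr1 normc_norm normc_real ger0_norm ?normc_ge0.
Qed.

(** If the first inequality fails, then |1 - a| <= 1 - |a| < 1, so 1/|1 - a| alone exceeds 1. *)
Lemma normc_sum_gt1 (a : R[i]) : a != 0 -> a != 1 ->
  1 < normc a + normc (1 - a) \/ 1 < normc (1 - a)^-1 + normc (1 - (1 - a)^-1).
Proof.
move=> a0 a1; case: ltP => [|/[dup] h /normc_sum_le1 e]; [by left|right].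
have b0 : 0 < normc a by rewrite normc_gt0.
have b1 : 0 < normc (1 - a) by rewrite normc_gt0 subr_eq0 eq_sym.
have c1 : 1 < normc (1 - a)^-1 by rewrite normcV invf_gt1 //; lra.
have := normc_ge0 (1 - (1 - a)^-1); lra.
Qed.

Lemma cross_eq_affine a x y z : a != 0 -> a != 1 -> x <> y ->
  z = (1 - a) * x + a * y ->
  cross_eq a (finpt z, finpt y, finpt x, infpt).
Proof.
move=> a0 a1 xy ->; apply: cross_eqI => //.
  by rewrite mulf_neq0 // bracket_eq0 //; apply/eqP => -[].
by rewrite /cross_num /cross_den /bracket /=; ring.
Qed.

Lemma cross_eq_affineE a x y z :
  cross_eq a (finpt z, finpt y, finpt x, infpt) -> z = (1 - a) * x + a * y.
Proof.
move=> [_]; rewrite /cross_num /cross_den /bracket /= => e.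
have {e} : a * (x - y) = x - z.
  transitivity (a * ((x * 1 - y * 1) * (1 * 1 - z * 0))); first by ring.
  by rewrite -e; ring.
move=> /eqP; rewrite eq_sym subr_eq => /eqP e.
by apply: (addrI (a * (x - y))); rewrite -e; ring.
Qed.

(** * Spreading of finite values for a map that fixes infinity *)

Section FiniteBall.
Variables (a : R[i]) (V : set (sphere R)) (f : sphere R -> sphere R).
Hypotheses (a0 : a != 0) (a1 : a != 1) (pf : preserves_cross a V f).
Hypotheses (Vinf : V infpt) (finf : f infpt = infpt).

(** The sum counts finite images. If exactly one of the three images were infinite, then together
    with [f infpt] the image would be a tetrad with just two equal elements, yet preservation makes
    it nonsingular. *)
Lemma affine_third x y z : x <> y -> z = (1 - a) * x + a * y ->
  V (finpt x) -> V (finpt y) -> V (finpt z) ->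
  ((f (finpt x) != infpt) + (f (finpt y) != infpt) + (f (finpt z) != infpt) != 2)%N.
Proof.
move=> xy zE Vx Vy Vz; have eT := cross_eq_affine a0 a1 xy zE.
have := pf _ eT; rewrite /= finf => h.
have {}h := h (And4 Vz Vy Vx Vinf).
case: (f (finpt x) =P infpt) => [ex|ex]; case: (f (finpt y) =P infpt) => [ey|ey];
  case: (f (finpt z) =P infpt) => [ez|ez] //=.
- have : tetrad (f (finpt z), f (finpt y), infpt, infpt : sphere R).
    by split=> -[? ?]; congruence.
  by rewrite ex in h => /h[/nonsingularP[_ _ _ [_ _]]].
- have : tetrad (f (finpt z), infpt, f (finpt x), infpt : sphere R).
    by split=> -[? ?]; congruence.
  by rewrite ey in h => /h[/nonsingularP[_ _ _ [_ ]]].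
- have : tetrad (infpt, f (finpt y), f (finpt x), infpt : sphere R).
    by split=> -[? ?]; congruence.
  by rewrite ez in h => /h[/nonsingularP[_ _ ]].
Qed.

Lemma finite_on_ball c r rho : 0 < r ->
  (forall u, normc (u - c) < rho -> V (finpt u)) ->
  (forall u, normc (u - c) < r -> f (finpt u) <> infpt) ->
  forall u, normc (u - c) < rho -> f (finpt u) <> infpt.
Proof.
move=> r0 Vrho fr.
have [rho0|rho0] := leP rho 0.
  by move=> u /lt_le_trans /(_ rho0); rewrite ltNge normc_ge0.
pose O u := V (finpt u) /\ f (finpt u) <> infpt.
suff grow l : l != 0 -> l != 1 -> 1 < normc l + normc (1 - l) ->
    (forall x y, x <> y -> O x -> O y ->
      normc ((1 - l) * x + l * y - c) < rho -> O ((1 - l) * x + l * y)) ->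
    forall u, normc (u - c) < rho -> f (finpt u) <> infpt.
  have a1' : 1 - a != 0 by rewrite subr_eq0 eq_sym.
  have [ha|ha] := normc_sum_gt1 a0 a1.
    apply: grow ha _ => // x y xy [Vx /eqP fx] [Vy /eqP fy] /Vrho Vz; split => //.
    have := affine_third xy erefl Vx Vy Vz.
    by rewrite fx fy => h e; rewrite e eqxx in h.
  (* For l = 1/(1 - a), the new point z = (1 - l) x + l y satisfies y = (1 - a) z + a x: the same
     affine relation with the points permuted. *)
  apply: grow ha _; first by rewrite invr_eq0.
    by rewrite invr_eq1 subr_eq addrC -subr_eq subrr eq_sym.
  move=> x y xy [Vx /eqP fx] [Vy /eqP fy] /Vrho; set z := _ + _ => Vz; split => //.
  have zx : z <> x.
    move=> /eqP; rewrite -subr_eq0.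
    rewrite (_ : _ - _ = (1 - a)^-1 * (y - x)); last by rewrite /z; ring.
    rewrite mulf_eq0 invr_eq0 (negPf a1') subr_eq0 /= => /eqP e.
    by apply: xy.
  have yE : y = (1 - a) * z + a * x by rewrite /z; field.
  have := affine_third zx yE Vz Vx Vy.
  by rewrite fx fy => h e; rewrite e eqxx in h.
move=> l0 l1 hl Ol u urho.
have rm : 0 < Num.min r rho by rewrite lt_min r0.
have Om v : normc (v - c) < Num.min r rho -> O v.
  by rewrite lt_min => /andP[/fr ? /Vrho ?].
by have [] := ball_growth hl l0 l1 rm Om Ol urho.
Qed.

End FiniteBall.
End Growth.

(** * Rigidity of injective maps *)

Section LocallyAdditive.
Variables (R : realType) (G : R[i] -> R[i]) (delta : R).
Hypothesis delta0 : 0 < delta.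
Hypothesis Gadd : forall u v, normc u < delta -> normc v < delta ->
  G (u + v) = G u + G v.
Hypothesis Gcont : forall e : R, 0 < e ->
  exists2 eta, 0 < eta & forall u, normc u < eta -> normc (G u) < e.

Let G0 : G 0 = 0.
Proof.
have : G (0 + 0) = G 0 + G 0 by apply: Gadd; rewrite normc0.
by rewrite addr0 => /eqP; rewrite -subr_eq0 opprD addrA subrr sub0r oppr_eq0 => /eqP.
Qed.

Let Gopp u : normc u < delta -> G (- u) = - G u.
Proof.
move=> ud; apply/eqP; rewrite -addr_eq0 addrC -Gadd ?normcN //.
by rewrite subrr G0.
Qed.

Let normc_scale (t : R) (u : R[i]) : normc (t%:C * u) = `|t| * normc u.
Proof. by rewrite normcM normc_real. Qed.

(** Repeated addition of u/(n + 1); the bound k <= n + 1 keeps every partial sum in the disc where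
    [G] is additive. *)
Let Gfrac u n k : normc u < delta -> (k <= n.+1)%N ->
  G ((k%:R / n.+1%:R)%:C * u) = (k%:R / n.+1%:R)%:C * G u.
Proof.
move=> ud; have n0 : 0 < n.+1%:R :> R by rewrite ltr0n.
have step j : (j <= n.+1)%N ->
    G ((j%:R / n.+1%:R)%:C * u) = j%:R * G ((n.+1%:R^-1)%:C * u).
  elim: j => [_|j IHj jn]; first by rewrite !mul0r G0.
  have -> : (j.+1%:R / n.+1%:R)%:C * u =
      (j%:R / n.+1%:R)%:C * u + (n.+1%:R^-1)%:C * u.
    by rewrite -mulrDl -rmorphD -(natr1 j) mulrDl mul1r.
  rewrite Gadd.
  - by rewrite IHj 1?ltnW // -(natr1 j) mulrDl mul1r.
  - rewrite normc_scale ger0_norm ?divr_ge0 //; apply: le_lt_trans ud.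
    by rewrite ler_piMl ?normc_ge0 // ler_pdivrMr // mul1r ler_nat ltnW.
  - rewrite normc_scale ger0_norm ?invr_ge0 //; apply: le_lt_trans ud.
    by rewrite ler_piMl ?normc_ge0 // invf_le1 // ler1n.
move=> kn; rewrite step // -{2}[u]mul1r.
have -> : G (1 * u) = n.+1%:R * G ((n.+1%:R^-1)%:C * u).
  by rewrite -step // divff ?gt_eqF.
rewrite mulrA; congr (_ * _).
have cast m : m%:R = (m%:R : R)%:C :> R[i] by rewrite rmorph_nat.
by rewrite (cast k) (cast n.+1) -rmorphM divfK ?gt_eqF.
Qed.

(** Let d > 0 be the error and write t = m/(n + 1) + s with 0 <= s < 1/(n + 1). The fraction
    contributes no error, so d <= |G(su)| + |s G(u)|, and both terms are below d/2 for large n. *)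
Let Gscale01 (t : R) u : 0 <= t <= 1 -> normc u < delta ->
  G (t%:C * u) = t%:C * G u.
Proof.
move=> /andP[t0 t1] ud; apply/eqP; rewrite -subr_eq0 -normr_eq0; apply/negPn/negP.
rewrite normr_eq0 -normc_gt0; set d := normc _ => d0.
have d20 : 0 < d / 2 by rewrite divr_gt0.
have [eta eta0 etaP] := Gcont d20.
(* Once n + 1 > K, both |u|/(n + 1) < eta and |G u|/(n + 1) < d/2 hold. *)
pose K := normc u / eta + normc (G u) / (d / 2).
have K0 : 0 <= K.
  by rewrite addr_ge0 // divr_ge0 ?normc_ge0 // ltW // divr_gt0.
set n := Num.bound K; have Kn : K < n.+1%:R.
  by apply: lt_trans (archi_boundP K0) _; rewrite ltr_nat.
have n0 : 0 < n.+1%:R :> R by rewrite ltr0n.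
have tn0 : 0 <= t * n.+1%:R by rewrite mulr_ge0.
have /andP[] := truncn_itv tn0; set m := Num.truncn _ => m1 m2.
have mn : (m <= n.+1)%N.
  by rewrite -(ler_nat R); apply: le_trans m1 _; rewrite ler_piMl.
pose s := t - m%:R / n.+1%:R.
have s0 : 0 <= s by rewrite subr_ge0 ler_pdivrMr.
have s1 : s < n.+1%:R^-1.
  by rewrite ltrBlDl -[X in _ + X]mul1r -mulrDl natr1 ltr_pdivlMr.
have E1 : t%:C * u = (m%:R / n.+1%:R)%:C * u + s%:C * u.
  by rewrite -mulrDl -rmorphD /s addrC subrK.
have E2 : t%:C * G u = (m%:R / n.+1%:R)%:C * G u + s%:C * G u.
  by rewrite -mulrDl -rmorphD /s addrC subrK.
have h1 : normc u < n.+1%:R * eta.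
  rewrite -ltr_pdivrMr //; apply: le_lt_trans Kn.
  by rewrite /K lerDl divr_ge0 ?normc_ge0 // ltW // divr_gt0.
have h2 : normc (G u) < n.+1%:R * (d / 2).
  rewrite -ltr_pdivrMr ?divr_gt0 //; apply: le_lt_trans Kn.
  by rewrite /K lerDr divr_ge0 ?normc_ge0 // ltW.
have sx (x : R[i]) e : 0 < e -> normc x < n.+1%:R * e -> normc (s%:C * x) < e.
  move=> e0 xe; rewrite normc_scale ger0_norm //.
  apply: (@le_lt_trans _ _ (n.+1%:R^-1 * normc x)).
    by rewrite ler_wpM2r ?normc_ge0 // ltW.
  by rewrite mulrC ltr_pdivrMr // mulrC.
have small (r : R) : 0 <= r <= 1 -> normc (r%:C * u) < delta.
  move=> /andP[r0 r1]; rewrite normc_scale ger0_norm //; apply: le_lt_trans ud.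
  by rewrite ler_piMl ?normc_ge0.
have s11 : s <= 1.
  by apply: le_trans (ltW s1) _; rewrite invf_le1 // ler1n.
move: (lexx d); rewrite {2}/d E1 E2 Gadd; last first.
- by apply: small; rewrite s0.
- apply: small; rewrite divr_ge0 // ?ler0n //=.
  by rewrite ler_pdivrMr // mul1r ler_nat.
rewrite Gfrac // opprD addrACA subrr add0r.
have := le_normcD (G (s%:C * u)) (- (s%:C * G u)); rewrite normcN.
have := etaP _ (sx _ _ eta0 h1); have := sx _ _ d20 h2.
by lra.
Qed.

Let Gscale (t : R) u : `|t| <= 1 -> normc u < delta ->
  G (t%:C * u) = t%:C * G u.
Proof.
move=> t1 ud; have [t0|/ltW t0] := leP 0 t.
  by rewrite Gscale01 // t0 -(ger0_norm t0).
rewrite -[t in LHS]opprK rmorphN mulNr Gopp ?Gscale01 //.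
- by rewrite rmorphN mulNr opprK.
- by rewrite oppr_ge0 t0 -(ler0_norm t0).
- by rewrite normc_scale normrN; apply: le_lt_trans ud; rewrite ler_piMl ?normc_ge0.
Qed.

Lemma locally_additive_linear : exists A B : R[i], forall u,
  normc u < delta / 2 -> G u = (Re u)%:C * A + (Im u)%:C * B.
Proof.
pose s := delta / 2; have s0 : 0 < s by rewrite divr_gt0.
have sd : s < delta by rewrite gtr_pMr // invf_lt1 ?ltr1n ?ltr0n.
have sC : s%:C != 0 :> R[i] by rewrite -normc_gt0 normc_real normr_gt0 gt_eqF.
have Gs (x : R) (v : R[i]) : normc v <= 1 -> `|x| < s ->
    G (x%:C * v) = x%:C * (G (s%:C * v) / s%:C).
  move=> v1 xs; have sv : normc (s%:C * v) < delta.
    rewrite normc_scale ger0_norm ?ltW //; apply: le_lt_trans sd.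
    by rewrite ler_piMr // ltW.
  have -> : x%:C * v = (x / s)%:C * (s%:C * v).
    by rewrite mulrA -rmorphM divfK ?gt_eqF.
  rewrite Gscale //; last first.
    by rewrite normrM normfV (gtr0_norm s0) ler_pdivrMr // mul1r ltW.
  by rewrite rmorphM fmorphV mulrCA mulrC.
(* The points 1 and i may lie outside the disc, so the coefficients are read off at s and s i and
   divided by s. *)
exists (G (s%:C * 1) / s%:C), (G (s%:C * (0 +i* 1)) / s%:C) => u us.
have ni : normc (0 +i* 1 : R[i]) = 1.
  by rewrite /= expr0n /= expr1n add0r sqrtr1.
have rs : `|Re u| < s by apply: le_lt_trans us; exact: normr_Re_le.
have ims : `|Im u| < s by apply: le_lt_trans us; exact: normr_Im_le.
rewrite -Gs ?normc1 // -Gs ?ni // -Gadd.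
- by congr G; case: (u) => x y /=; simpc.
- by rewrite mulr1 normc_real (lt_trans rs).
- by rewrite normc_scale ni mulr1 (lt_trans ims).
Qed.

End LocallyAdditive.

(** * Complex conjugation on the sphere *)

Section Conjugation.
Variable R : realType.
Implicit Types (a : R[i]) (T : quad R).

(** Conjugation is taken as the reflection in the real axis, so that it is a Moebius transformation
    by construction. *)
Definition conj_sphere : sphere R -> sphere R := line_refl 0 1.

Lemma conj_sphere_finpt (x : R[i]) : conj_sphere (finpt x) = finpt x^*%C.
Proof.
rewrite -[LHS]/(finpt (0 + 1 / 1^*%C * (x - 0)^*%C)).
by rewrite conjc1 divr1 mul1r add0r subr0.
Qed.

(** Homogeneous coordinates, hence brackets, are conjugated, so the ratio becomes the conjugate of
    [a], which is [a] itself. *)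
Lemma cross_eq_conj a T : Im a = 0 -> cross_eq a T ->
  cross_eq a (quad_map conj_sphere T).
Proof.
move=> ima; have ca : a^*%C = a by case: a ima => x y /= ->; rewrite oppr0.
have hxJ z : hx (conj_sphere z) = (hx z)^*%C.
  case: z => [x|]; last by rewrite [RHS]conjc1.
  by rewrite -/(finpt x) conj_sphere_finpt.
have hyJ z : hy (conj_sphere z) = (hy z)^*%C.
  case: z => [x|]; last by rewrite [RHS]conjc0.
  by rewrite -/(finpt x) conj_sphere_finpt [RHS]conjc1.
have bJ z w : bracket (conj_sphere z) (conj_sphere w) = (bracket z w)^*%C.
  by rewrite /bracket !hxJ !hyJ rmorphB !rmorphM.
have inj : injective conj_sphere.
  move=> z w /eqP; rewrite -bracket_eq0 bJ conjc_eq0 bracket_eq0; exact: eqP.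
case: T => [[[z1 z2] z3] z4] [/nonsingularP nT e]; split.
  case: nT => h12 h13 h14 [h23 h24 h34].
  by apply/nonsingularP; split; [| | |split] => /inj.
rewrite /cross_num /cross_den /= !bJ -!rmorphM -[in RHS]ca -rmorphM /=.
by congr conjc.
Qed.

End Conjugation.

(** * Injective maps fixing infinity agree with a Moebius transformation *)

Section Rigidity.
Variables (R : realType) (a p : R[i]) (V : set (sphere R)).
Variables (f : sphere R -> sphere R) (rho : R).
Hypotheses (a0 : a != 0) (a1 : a != 1) (pf : preserves_cross a V f).
Hypotheses (Vinf : V infpt) (finf : f infpt = infpt).
Hypothesis finj : forall z w, V z -> V w -> f z = f w -> z = w.
Hypothesis rho0 : 0 < rho.
Hypothesis Vp : forall u : R[i], normc (u - p) < rho -> V (finpt u).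

Let F (u : R[i]) : R[i] := chart infpt (f (finpt u)).

Hypothesis Fcont : forall e : R, 0 < e -> exists2 eta, 0 < eta &
  forall u : R[i], normc (u - p) < eta -> normc (F u - F p) < e.

Let a1' : 1 - a != 0. Proof. by rewrite subr_eq0 eq_sym. Qed.

Let fF u : V (finpt u) -> f (finpt u) = finpt (F u).
Proof.
move=> Vu; rewrite /F; case E : (f (finpt u)) => [x|] //.
by have := finj Vu Vinf; rewrite E finf => /(_ erefl).
Qed.

Let cross_f T : quad_in V T -> cross_eq a T -> cross_eq a (quad_map f T).
Proof.
move=> TV eT; apply: pf => //; apply: nonsingular_tetrad.
case: eT TV => + _; case: T => [[[z1 z2] z3] z4] /nonsingularP.
case=> h12 h13 h14 [h23 h24 h34] [V1 V2 V3 V4]; apply/nonsingularP.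
by split; [| | |split] => /finj; auto.
Qed.

Let F_affine x y z : V (finpt x) -> V (finpt y) -> V (finpt z) ->
  z = (1 - a) * x + a * y -> F z = (1 - a) * F x + a * F y.
Proof.
move=> Vx Vy Vz zE; have [xy|/eqP xy] := eqVneq x y.
  rewrite -{}xy in zE *; have -> : z = x by rewrite zE; ring.
  by ring.
have := @cross_f (finpt z, finpt y, finpt x, infpt) (And4 Vz Vy Vx Vinf)
  (cross_eq_affine a0 a1 xy zE).
by rewrite /= finf !fF // => /cross_eq_affineE.
Qed.

Let G u := F (p + u) - F p.

Let Vpu u : normc u < rho -> V (finpt (p + u)).
Proof. by move=> ur; apply: Vp; rewrite addrC addKr. Qed.

Let G0 : G 0 = 0. Proof. by rewrite /G addr0 subrr. Qed.

Let rho00 : normc (0 : R[i]) < rho. Proof. by rewrite normc0. Qed.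

Let G_affine u v : normc u < rho -> normc v < rho ->
  normc ((1 - a) * u + a * v) < rho ->
  G ((1 - a) * u + a * v) = (1 - a) * G u + a * G v.
Proof.
move=> hu hv huv; rewrite /G.
rewrite (@F_affine (p + u) (p + v) (p + ((1 - a) * u + a * v))); try exact: Vpu.
  by ring.
by ring.
Qed.

Let G_scale u : normc u < rho -> normc (a * u) < rho -> G (a * u) = a * G u.
Proof.
move=> hu hau; have := G_affine rho00 hu.
by rewrite !mulr0 add0r G0 mulr0 add0r; apply.
Qed.

Let G_scale' u : normc u < rho -> normc ((1 - a) * u) < rho ->
  G ((1 - a) * u) = (1 - a) * G u.
Proof.
move=> hu hau; have := G_affine hu rho00.
by rewrite !mulr0 !addr0 G0 mulr0 addr0; apply.
Qed.

(** The bound rho/2 keeps u + v in the disc of radius [rho]; the other two keep u/(1 - a) and v/a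
    there. *)
Let delta := Num.min (rho / 2) (Num.min (rho * normc a) (rho * normc (1 - a))).

Let na : 0 < normc a. Proof. by rewrite normc_gt0. Qed.
Let na' : 0 < normc (1 - a). Proof. by rewrite normc_gt0. Qed.

Let delta0 : 0 < delta.
Proof. by rewrite !lt_min divr_gt0 // !mulr_gt0. Qed.

(** Write u + v = (1 - a) u' + a v'. The affine relation splits this sum, and its special cases with
    one argument 0 turn the two terms back into [G u] and [G v]. *)
Let G_add u v : normc u < delta -> normc v < delta -> G (u + v) = G u + G v.
Proof.
rewrite !lt_min => /and3P[u1 _ u3] /and3P[v1 v2 _].
pose u' := u / (1 - a); pose v' := v / a.
have uE : (1 - a) * u' = u by rewrite mulrC divfK.
have vE : a * v' = v by rewrite mulrC divfK.
have hu' : normc u' < rho by rewrite normcM normcV ltr_pdivrMr.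
have hv' : normc v' < rho by rewrite normcM normcV ltr_pdivrMr.
have ur : normc u < rho by apply: lt_trans u1 _; have := rho0; lra.
have vr : normc v < rho by apply: lt_trans v1 _; have := rho0; lra.
rewrite -{1}uE -{1}vE G_affine //.
  by rewrite -G_scale' ?uE // -G_scale ?vE.
by rewrite uE vE; have := le_normcD u v; lra.
Qed.

Let G_cont e : 0 < e ->
  exists2 eta, 0 < eta & forall u, normc u < eta -> normc (G u) < e.
Proof.
move=> /Fcont[eta eta0 he]; exists eta => // u ue; apply: he.
by rewrite addrC addKr.
Qed.

Let G_inj u : normc u < rho -> G u = 0 -> u = 0.
Proof.
move=> ur /eqP; rewrite subr_eq0 => /eqP e.
have Vp0 : V (finpt p) by apply: Vp; rewrite subrr normc0.
have := finj (Vpu ur) Vp0; rewrite fF ?fF //; last exact: Vpu.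
rewrite e => /(_ erefl) [] /eqP; rewrite -subr_eq0 addrC addKr => /eqP; exact.
Qed.

Let conj_if (b : bool) (u : R[i]) : R[i] := if b then u^*%C else u.

Lemma local_rigidity : exists (A : R[i]) (b : bool) (s : R),
  [/\ A != 0, 0 < s <= rho, (b -> Im a = 0) &
    forall u, normc (u - p) < s -> F u = F p + A * conj_if b (u - p)].
Proof.
have [A [B GAB]] := locally_additive_linear delta0 G_add G_cont.
set s := delta / 2 in GAB.
have sr : s <= rho.
  have : delta <= rho / 2 by rewrite /delta ge_min lexx.
  by rewrite /s; have := delta0; lra.
have s0 : 0 < s by rewrite divr_gt0.
have sub b : (forall u, normc u < s -> G u = A * conj_if b u) ->
    forall u, normc (u - p) < s -> F u = F p + A * conj_if b (u - p).
  move=> h u us; rewrite -h // /G addrC subrK; congr F; ring.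
(* [eps] brings 1, a, 1 - a, i - a and 1 + a i, of norm at most [M], into the
   disc of radius [s]. *)
pose M := 2 + normc a.
have M1 : 1 < M by rewrite /M; have := na; lra.
pose eps := s / (2 * M).
have eps0 : 0 < eps by rewrite divr_gt0 // mulr_gt0 //; lra.
have epsM u : normc u <= M -> normc (eps%:C * u) < s.
  move=> uM; rewrite normcM normc_real gtr0_norm // /eps mulrAC.
  by rewrite ltr_pdivrMr ?mulr_gt0 //; nra.
have GE (x y : R) : normc (x +i* y) <= M ->
    G (eps%:C * (x +i* y)) = eps%:C * (x%:C * A + y%:C * B).
  move=> h; rewrite GAB ?epsM //=; simpc.
  by rewrite !rmorphM; ring.
have n1 : normc (1 : R[i]) <= M by rewrite normc1 ltW.
have G1 : G (eps%:C * 1) = eps%:C * A.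
  by rewrite (GE 1 0) //; rewrite rmorph1 rmorph0; ring.
have epsC : eps%:C != 0 :> R[i] by rewrite -normc_gt0 normc_real normr_gt0 gt_eqF.
have A0 : A != 0.
  apply: contraNneq epsC => A0; apply/eqP; rewrite -[LHS]mulr1; apply: G_inj.
    by apply: lt_le_trans (epsM _ n1) sr.
  by rewrite G1 A0 mulr0.
pose I : R[i] := 0 +i* 1.
have II : I * I = -1 by rewrite -expr2; exact: sqr_i.
have uE (u : R[i]) : u = (Re u)%:C + I * (Im u)%:C by rewrite {1}[u]complexE.
have linear_case : B = I * A -> forall u, normc u < s -> G u = A * conj_if false u.
  by move=> BE u us; rewrite GAB // BE {3}[u]uE /=; ring.
(* For nonreal [a], comparing G(a eps) = a G(eps) with the real linear formula gives Im(a) B = Im(a)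
   I A, hence B = I A. *)
have [ima|ima] := eqVneq (Im a) 0; last first.
  exists A, false, s; split; rewrite ?s0 //; apply/sub/linear_case.
  have naM : normc a <= M by rewrite /M; lra.
  have := @GE (Re a) (Im a); have <- : a = Re a +i* Im a by case: (a).
  move=> /(_ naM).
  have e1 : normc (eps%:C : R[i]) < rho.
    by rewrite -[eps%:C]mulr1; apply: lt_le_trans (epsM _ n1) sr.
  have e2 : normc (a * eps%:C) < rho.
    by rewrite mulrC; apply: lt_le_trans (epsM _ naM) sr.
  rewrite [eps%:C * a]mulrC G_scale // -[X in G X]mulr1 G1 mulrCA.
  move=> /(mulfI epsC); rewrite {1}[a]uE mulrDl => /addrI e.
  have imaC : (Im a)%:C != 0 :> R[i] by rewrite -normc_gt0 normc_real normr_gt0.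
  by apply: (mulfI imaC); rewrite -e; ring.
have aE : a = (Re a)%:C by rewrite {1}[a]uE ima rmorph0 mulr0 addr0.
have normI : normc I = 1 by rewrite /= expr0n /= expr1n add0r sqrtr1.
pose u1 := 1 - a; pose u2 := I - a; pose u3 := 1 + a * I.
have u1M : normc u1 <= M.
  by have := le_normcD 1 (- a); rewrite normcN normc1 /M /u1; lra.
have u2M : normc u2 <= M.
  by have := le_normcD I (- a); rewrite normcN normI /M /u2; lra.
have u3M : normc u3 <= M.
  by have := le_normcD 1 (a * I); rewrite normcM normI normc1 mulr1 /M /u3; lra.
have Gu1 : G (eps%:C * u1) = eps%:C * ((1 - a) * A).
  have E : u1 = (1 - Re a) +i* 0.
    by rewrite /u1 {1}aE; simpc; rewrite ?oppr0 ?addr0 ?subr0.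
  by rewrite E GE -?E // aE; rewrite rmorphB rmorph1 /=; ring.
have Gu2 : G (eps%:C * u2) = eps%:C * (B - a * A).
  have E : u2 = (- Re a) +i* 1 by rewrite /u2 {1}aE /I; simpc.
  by rewrite E GE -?E // aE rmorphN rmorph1 /=; ring.
have Gu3 : G (eps%:C * u3) = eps%:C * (A + a * B).
  have E : u3 = 1 +i* Re a by rewrite /u3 {1}aE /I; simpc.
  by rewrite E GE -?E // [in RHS]aE rmorph1 /=; ring.
have Vu u : normc u <= M -> V (finpt (p + eps%:C * u)).
  by move=> uM; apply: Vpu; apply: lt_le_trans (epsM _ uM) sr.
have FG u : F (p + u) = F p + G u by rewrite /G [RHS]addrC subrK.
have Vp0 : V (finpt p) by apply: Vp; rewrite subrr normc0.
have I1 : I - 1 != 0.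
  by rewrite subr_eq0; apply/eqP => -[/eqP]; rewrite eq_sym oner_eq0.
have u30 : u3 != 0.
  rewrite /u3 {1}aE /I; apply/eqP; simpc => -[/eqP]; by rewrite oner_eq0.
have /cross_f : cross_eq a (finpt p, finpt (p + eps%:C * u1),
    finpt (p + eps%:C * u2), finpt (p + eps%:C * u3)).
  apply: cross_eqI => //; rewrite /cross_num /cross_den /bracket /=.
    rewrite (_ : _ * _ = eps%:C ^+ 2 * ((I - 1) * u3)); last first.
      by rewrite /u2 /u1; ring.
    by rewrite !mulf_neq0 // expf_neq0.
  (* The two sides differ by a multiple of 1 + I^2; with that term added the identity holds for an
     arbitrary [I]. *)
  transitivity (a * (eps%:C ^+ 2 * ((I - 1) * u3)) -
      a * eps%:C ^+ 2 * (a - 1) * (1 + I * I)).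
    by rewrite /u1 /u2 /u3; ring.
  by rewrite II subrr mulr0 subr0 /u1 /u2; ring.
case/(_ (And4 Vp0 (Vu _ u1M) (Vu _ u2M) (Vu _ u3M))) => _.
rewrite /quad_map (fF Vp0) (fF (Vu _ u1M)) (fF (Vu _ u2M)) (fF (Vu _ u3M)) !FG.
rewrite Gu1 Gu2 Gu3 /cross_num /cross_den /bracket /= => e.
(* The ratio of the image tetrad amounts to A^2 + B^2 = 0, factored over the complex numbers: B = I
   A is the linear case, B = - I A the conjugate-linear one. *)
have {}e : (a * eps%:C ^+ 2 * (1 - a)) * ((B - I * A) * (B + I * A)) = 0.
  rewrite (_ : _ * (B + I * A) = A * A + B * B - A * A * (1 + I * I)); last by ring.
  rewrite II subrr mulr0 subr0.
  by move/eqP: e; rewrite -subr_eq0 => /eqP <-; ring.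
move/eqP: e; rewrite !mulf_eq0 (negPf a0) (negPf a1') (negPf epsC) /=.
case/orP; rewrite ?subr_eq0 ?addr_eq0 => /eqP BE.
  by exists A, false, s; split; rewrite ?s0 //; apply/sub/linear_case.
exists A, true, s; split; rewrite ?s0 //; apply/sub => u us.
rewrite GAB // BE /=.
have -> : u^*%C = (Re u)%:C - I * (Im u)%:C by case: (u) => x y; rewrite /I; simpc.
by ring.
Qed.

Lemma rigidity : exists g : sphere R -> sphere R,
  (is_lin_frac g \/
    Im a = 0 /\ exists2 h, is_lin_frac h & g = h \o @conj_sphere R) /\
  forall z, V z -> f z = g z.
Proof.
have [A [b [s [A0 /andP[s0 sr] ima FM]]]] := local_rigidity.
pose C := F p - A * conj_if b p.
pose h : sphere R -> sphere R := lin_frac A C 0 1.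
have lh : is_lin_frac h by exists A, C, 0, 1; rewrite mulr1 mulr0 subr0.
pose g := h \o (if b then @conj_sphere R else id).
have gE u : g (finpt u) = finpt (A * conj_if b u + C).
  have hE v : h (finpt v) = finpt (A * v + C).
    by rewrite /h /= mul0r add0r oner_eq0 divr1.
  rewrite -hE -[LHS]/(h ((if b then @conj_sphere R else id) (finpt u))).
  by congr (h _); rewrite /conj_if; case: (b); rewrite ?conj_sphere_finpt.
have gcross T : cross_eq a T -> cross_eq a (quad_map g T).
  have -> : quad_map g T =
      quad_map h (quad_map (if b then @conj_sphere R else id) T).
    by case: T => [[[? ?] ?] ?].
  move=> eT; apply: cross_eq_lin_frac => //.
  case: (b) ima => ima; first by apply: cross_eq_conj => //; exact: ima.
  by case: T eT => [[[? ?] ?] ?].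
exists g; split.
  rewrite /g; case: (b) ima => ima; [right|left] => //.
  by split; [exact: ima|exists h].
have fg u : normc (u - p) < s -> f (finpt u) = g (finpt u).
  move=> us; rewrite gE fF; last by apply: Vp; exact: lt_le_trans sr.
  rewrite FM // /C; congr finpt.
  have -> : conj_if b (u - p) = conj_if b u - conj_if b p.
    by rewrite /conj_if; case: (b); rewrite ?rmorphB.
  by ring.
move=> z Vz; have [->|/eqP zp] := eqVneq z (finpt p).
  by apply: fg; rewrite subrr normc0.
(* In the coordinate [chart z], the points near [p] form an affine tetrad
   with [z], which is at infinity there. *)
pose P := chart z (finpt p).
have : nbhs P (ichart z @^-1` [set w | exists2 v, w = finpt v & normc (v - p) < s]).
  apply: ichart_continuous; rewrite chartK; last by move/esym.
  rewrite nbhs_finpt; apply/nbhs_normc; exists s => // v vs; by exists v.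
case/nbhs_normc => eta eta0 near_p.
(* Both y and c must lie within [eta] of P; their distances to P are e and |a| e. *)
pose e := eta / (2 * (1 + normc a)).
have na1 : 0 < 1 + normc a by have := na; lra.
have e0 : 0 < e by rewrite divr_gt0 // mulr_gt0.
have eE : e * (2 * (1 + normc a)) = eta by rewrite divfK // gt_eqF // mulr_gt0.
have [e1 e2] : e < eta /\ normc a * e < eta.
  have ena : 0 < e * normc a by rewrite mulr_gt0.
  by rewrite -eE; split; lra.
have eC : e%:C != 0 :> R[i] by rewrite -normc_gt0 normc_real normr_gt0 gt_eqF.
pose y := P + e%:C; pose c := (1 - a) * P + a * y.
have [v1 v1E v1s] : exists2 v, ichart z y = finpt v & normc (v - p) < s.
  by apply: near_p; rewrite /y addrC addKr normc_real gtr0_norm.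
have [v2 v2E v2s] : exists2 v, ichart z c = finpt v & normc (v - p) < s.
  apply: near_p; rewrite (_ : c - P = a * e%:C); last by rewrite /c /y; ring.
  by rewrite normcM normc_real gtr0_norm.
have Py : P <> y.
  move=> /eqP; rewrite -subr_eq0 /y opprD addrA subrr sub0r oppr_eq0.
  by rewrite (negPf eC).
have eT := cross_eq_lin_frac (is_lin_frac_of_inf z)
  (cross_eq_affine a0 a1 Py (erefl c)).
move: eT; rewrite /quad_map !of_inf_finpt of_inf_infpt v1E v2E.
rewrite chartK; last by move/esym.
move=> eT; have := gcross _ eT.
have ps : normc (p - p) < s by rewrite subrr normc0.
have Vs v : normc (v - p) < s -> V (finpt v).
  by move=> vs; apply: Vp; exact: lt_le_trans sr.
(* Both [f] and [g] keep the ratio of this tetrad and they agree on its first three points, so they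
   agree at [z]. *)
have := @cross_f (finpt v2, finpt v1, finpt p, z)
  (And4 (Vs _ v2s) (Vs _ v1s) (Vs _ ps) Vz) eT.
by rewrite /quad_map !fg //; exact: cross_eq_unique.
Qed.

End Rigidity.

(** * Moebius transformations *)

Section Moebius.
Variable R : realType.
Implicit Types (g h : sphere R -> sphere R) (b c k u x : R[i]).

Lemma moebius_reflection g : reflection g -> moebius g.
Proof. by move=> rg; exact: (moebius_comp rg (moebius_id R)). Qed.

Lemma moebius_mul g h : moebius g -> moebius h -> moebius (g \o h).
Proof.
move=> mg mh; elim: mg => // s g' rs _ IH.
by rewrite -compA; exact: moebius_comp.
Qed.

Lemma line_refl_finpt (p u x : R[i]) :
  line_refl p u (finpt x) = finpt (p + u / u^*%C * (x - p)^*%C).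
Proof. by []. Qed.

Lemma lin_frac_affine_finpt k b x :
  lin_frac k b 0 1 (finpt x) = finpt (k * x + b).
Proof. by rewrite /= mul0r add0r oner_eq0 divr1. Qed.

(** Two reflections in parallel lines orthogonal to [b], through 0 and b/2, compose to the
    translation by [b]. For b = 0 there is no such direction. *)
Lemma moebius_translation b : moebius (lin_frac 1 b 0 1).
Proof.
have [->|b0] := eqVneq b 0.
  rewrite (_ : lin_frac 1 0 0 1 = id); first exact: moebius_id.
  apply/funext => -[x|]; last by rewrite /= eqxx.
  by rewrite -/(finpt x) lin_frac_affine_finpt mul1r addr0.
pose w : R[i] := (0 +i* 1) * b.
have i0 : 0 +i* 1 != 0 :> R[i] by apply/eqP => -[/eqP]; rewrite oner_eq0.
have w0 : w != 0 by rewrite mulf_neq0.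
rewrite (_ : lin_frac 1 b 0 1 = line_refl (b / 2) w \o line_refl 0 w).
  by apply: moebius_mul; apply: moebius_reflection; constructor.
apply/funext => -[x|]; last by rewrite /= eqxx.
rewrite -/(finpt x) lin_frac_affine_finpt /comp !line_refl_finpt; congr finpt.
have wJ : w^*%C = - (0 +i* 1) * b^*%C.
  by rewrite rmorphM; congr (_ * _); apply/eqP; rewrite eq_complex /= oppr0 !eqxx.
have bJ0 : b^*%C != 0 by rewrite conjc_eq0.
have half : (b / 2)^*%C = b^*%C / 2.
  by rewrite fmorph_div; congr (_ / _); exact: (rmorph_nat (@conjc R) 2).
have e : w / w^*%C = - (b / b^*%C) by rewrite wJ /w; field; rewrite bJ0 i0.
have eJ : (- (b / b^*%C))^*%C = - (b^*%C / b).
  by rewrite rmorphN fmorph_div /= conjcK.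
rewrite e subr0 add0r mul1r.
have -> : (- (b / b^*%C) * x^*%C - b / 2)^*%C = - (b^*%C / b) * x - b^*%C / 2.
  by rewrite -half -eJ -{2}[x]conjcK -rmorphM -rmorphB.
by field; rewrite b0 bJ0.
Qed.

(** With k = u^2, the reflections in the real axis and in the line along [u] give multiplication by
    u / conj u, and the inversions of radii 1 and |u| give multiplication by |u|^2; the product of
    the two factors is u^2. *)
Lemma moebius_scale k : k != 0 -> moebius (lin_frac k 0 0 1).
Proof.
move=> k0; pose u := sqrtc k.
have uk : u ^+ 2 = k by rewrite sqr_sqrtc.
have u0 : u != 0 by rewrite -[_ == _](expf_eq0 u 2) uk.
have uJ0 : u^*%C != 0 by rewrite conjc_eq0.
have nu : 0 < normc u by rewrite normc_gt0.
rewrite (_ : lin_frac k 0 0 1 = (line_refl 0 u \o line_refl 0 1) \o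
    (circle_refl 0 (normc u) \o circle_refl 0 1)).
  by do 2?apply: moebius_mul; apply: moebius_reflection; constructor;
    rewrite ?oner_eq0.
apply/funext => -[x|]; last by rewrite /= !eqxx.
rewrite -/(finpt x) lin_frac_affine_finpt addr0 /=.
have [->|x0] := eqVneq x 0.
  rewrite -[circle_refl 0 _ infpt]/(finpt 0) !line_refl_finpt.
  by rewrite !(subr0, conjc0, mulr0, addr0).
have xJ0 : x^*%C != 0 by rewrite conjc_eq0.
have y0 : 0 + (1 ^+ 2)%:C / (x - 0)^*%C != 0 :> R[i].
  by rewrite add0r subr0 expr1n mul1r invr_eq0.
rewrite [circle_refl 0 _ _]/= (negPf y0) -/(finpt _) !line_refl_finpt; congr finpt.
have uuJ : ((normc u) ^+ 2)%:C = u * u^*%C.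
  by rewrite rmorphXn /= -normc_norm sqr_normc.
rewrite uuJ !(subr0, add0r, conjc1, expr1n, mul1r, divr1, invr1, rmorph1).
have xJV : (x^*%C^-1)^*%C = x^-1 by rewrite fmorphV /= conjcK.
rewrite conjcK xJV -uk.
by field; rewrite x0 uJ0.
Qed.

Lemma moebius_inversion : moebius (lin_frac 0 1 1 0 : sphere R -> sphere R).
Proof.
rewrite (_ : lin_frac 0 1 1 0 = line_refl 0 1 \o circle_refl 0 1).
  by apply: moebius_mul; apply: moebius_reflection; constructor; rewrite ?oner_eq0.
apply/funext => -[x|]; rewrite /comp.
  rewrite -/(finpt x) [LHS]/= [circle_refl _ _ _]/= mul1r addr0.
  have [//|x0] := eqVneq x 0.
  rewrite mul0r add0r -!/(finpt _) line_refl_finpt; congr finpt.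
  rewrite !(subr0, add0r, conjc1, expr1n, mul1r, divr1, invr1, rmorph1).
  by rewrite fmorphV /= conjcK.
rewrite -[circle_refl 0 _ None]/(finpt 0) line_refl_finpt.
by rewrite [LHS]/= oner_eq0 mul0r !(subr0, conjc0, mulr0, addr0).
Qed.

(** For c nonzero, (ax + b)/(cx + d) = a/c + (b - ad/c)/(cx + d) is an affine map, then 1/x, then an
    affine map. *)
Lemma is_lin_frac_moebius g : is_lin_frac g -> moebius g.
Proof.
have affine k b : k != 0 -> moebius (lin_frac k b 0 1).
  move=> k0; have -> : lin_frac k b 0 1 = lin_frac 1 b 0 1 \o lin_frac k 0 0 1.
    apply/funext => -[x|]; last by rewrite /= !eqxx /= ?eqxx.
    by rewrite -/(finpt x) /comp !lin_frac_affine_finpt mul1r addr0.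
  exact: moebius_mul (moebius_translation b) (moebius_scale k0).
move=> [a [b [c [d [det ->]]]]]; have [c0|c0] := eqVneq c 0.
  have [a0 d0] : a != 0 /\ d != 0.
    by move: det; rewrite c0 mulr0 subr0 mulf_eq0 negb_or => /andP.
  have -> : lin_frac a b c d = lin_frac (a / d) (b / d) 0 1.
    apply/funext => -[x|]; last by rewrite /= c0 !eqxx.
    rewrite -/(finpt x) lin_frac_affine_finpt /= c0 mul0r add0r (negPf d0).
    by congr finpt; field.
  by apply: affine; rewrite mulf_neq0 ?invr_eq0.
have k0 : b - a * d / c != 0.
  apply: contraNneq det => /(congr1 ( *%R^~ c)).
  by rewrite mulrBl divfK // mul0r => e; rewrite -opprB e oppr0.
have inv0 : 0 * 0 - 1 * 1 != 0 :> R[i].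
  by rewrite mulr0 sub0r mulr1 oppr_eq0 oner_eq0.
have -> : lin_frac a b c d =
    lin_frac (b - a * d / c) (a / c) 0 1 \o (lin_frac 0 1 1 0 \o lin_frac c d 0 1).
  rewrite lin_frac_comp //; last by rewrite mulr1 mulr0 subr0.
  rewrite lin_frac_comp; first by congr (lin_frac _ _ _ _); field.
    by rewrite mulr1 mulr0 subr0.
  rewrite (_ : _ - _ = - c); last by ring.
  by rewrite oppr_eq0.
apply: moebius_mul; first exact: affine.
exact: moebius_mul moebius_inversion (affine _ _ c0).
Qed.

End Moebius.

(** * Conclusion *)

Section Fibers.
Variables (R : realType) (a : R[i]) (U : set (sphere R)).
Variable f : sphere R -> sphere R.
Hypotheses (a0 : a != 0) (a1 : a != 1) (pf : preserves_cross a U f).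
Hypotheses (oU : open U) (cf : forall z, U z -> {for z, continuous f}).

(** This is [f] in coordinates that place [b] and [w] at infinity. *)
Let conj_at (b w : sphere R) := to_inf w \o f \o of_inf b.

Let conj_preserves b w :
  preserves_cross a (of_inf b @^-1` U) (conj_at b w).
Proof.
exact: preserves_cross_lin_frac (is_lin_frac_of_inf b) (is_lin_frac_to_inf w) pf.
Qed.

Let conj_infpt b : conj_at b (f b) infpt = infpt.
Proof. by rewrite /conj_at /comp of_inf_infpt to_inf_self. Qed.

Lemma nbhs_neq (w : sphere R) z : f z <> w -> U z -> nbhs z [set y | f y <> w].
Proof.
move=> fz Uz; suff h : nbhs (f z) (~` [set w]) by exact: (cf Uz h).
apply: open_nbhs_nbhs; split => //; apply: closed_openC.
apply: accessible_closed_set1.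
exact/hausdorff_accessible/sphere_hausdorff.
Qed.

Lemma ball_in_chart b p : p <> b -> U p -> exists2 rho, 0 < rho &
  forall u : R[i], normc (u - chart b p) < rho -> (of_inf b @^-1` U) (finpt u).
Proof.
move=> pb Up; have : nbhs (chart b p) (ichart b @^-1` U).
  by apply: ichart_continuous; rewrite chartK //; exact: open_nbhs_nbhs.
case/nbhs_normc => rho rho0 h; exists rho => // u ur.
by rewrite /preimage /= of_inf_finpt; exact: h.
Qed.

(** Suppose a point [c] within rho/2 of p, in the chart at [b], has an image other than [f b]. By
    continuity so has a small disc about [c], which grows to radius rho/2 without leaving the domain
    and then contains p, a contradiction. *)
Lemma fiber_nbhs b p : U b -> U p -> p <> b -> f p = f b ->
  nbhs p [set z | f z = f b].
Proof.
move=> Ub Up pb fpb; have [rho rho0 Vrho] := ball_in_chart pb Up.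
have ball_inf (c : R[i]) : normc (c - chart b p) < rho / 2 ->
    f (ichart b c) = f b.
  move=> cp; apply: contrapT => fc.
  have Uc : U (ichart b c).
    by rewrite -of_inf_finpt; apply: Vrho; apply: lt_trans cp _; lra.
  have : nbhs (c : R[i]^o) (ichart b @^-1` [set y | f y <> f b]).
    by apply: ichart_continuous; exact: nbhs_neq.
  case/nbhs_normc => r r0 fr.
  have : normc (chart b p - c) < rho / 2 by rewrite normc_distC.
  have Vc (v : R[i]) : normc (v - c) < rho / 2 -> (of_inf b @^-1` U) (finpt v).
    move=> vc; apply: Vrho.
    by have := le_normcD (v - c) (c - chart b p); rewrite addrA subrK; lra.
  have fc' (v : R[i]) : normc (v - c) < r -> conj_at b (f b) (finpt v) <> infpt.
    by move=> /fr /= h; rewrite /conj_at /comp of_inf_finpt to_inf_neq.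
  have Vinf : (of_inf b @^-1` U) infpt by rewrite /preimage /= of_inf_infpt.
  have fin := finite_on_ball a0 a1 (@conj_preserves b (f b)) Vinf (conj_infpt b)
    r0 Vc fc'.
  by move/fin; rewrite /conj_at /comp of_inf_finpt chartK // fpb to_inf_self.
have : nbhs (chart b p) [set u : R[i]^o | f (ichart b u) = f b].
  by apply/nbhs_normc; exists (rho / 2); rewrite ?divr_gt0.
move/(chart_continuous pb) => near_p.
apply: (@filterS _ _ (nbhs_filter p) _ _ _ near_p) => z /= h.
have [->//|/eqP zb] := eqVneq z b.
by rewrite -h chartK.
Qed.

(** The fiber of [f b] is nonempty, open and closed in the connected set [U]. *)
Lemma noninjective_constant b p : connected U -> U b -> U p -> p <> b ->
  f p = f b -> constant_on U f.
Proof.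
move=> cU Ub Up pb fpb; exists (f b).
suff <- : U `&` [set z | f z = f b] = U by move=> z [].
apply: cU; first by exists b.
  exists (U `&` [set z | f z = f b]); last by rewrite setIA setIid.
  rewrite openE => z [Uz /= fz]; apply: filterI; first exact: open_nbhs_nbhs.
  have [e|/eqP zb] := eqVneq z b; last exact: fiber_nbhs.
  (* At [b] itself the roles of [b] and [p] are exchanged. *)
  by rewrite e -fpb; apply: fiber_nbhs => //; exact/nesym.
exists (~` (U `&` [set z | f z <> f b])).
  apply: open_closedC; rewrite openE => z [Uz /= fz].
  by apply: filterI; [exact: open_nbhs_nbhs|exact: nbhs_neq].
rewrite predeqE => z; split => [[Uz fz]|[Uz h]]; split => //; first by case.
by apply: contrapT => fz; apply: h.
Qed.

Lemma injective_rigidity q :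
  (forall z w, U z -> U w -> f z = f w -> z = w) -> U q ->
  exists g : sphere R -> sphere R,
    (is_lin_frac g \/ Im a = 0 /\ moebius g) /\ forall z, U z -> f z = g z.
Proof.
move=> finj Uq.
have [p Up] : exists2 p, U p & p \notin [:: q].
  by apply: (nbhs_avoid (s := q)); exact: open_nbhs_nbhs.
rewrite inE => /eqP pq.
have [rho rho0 Vrho] := ball_in_chart pq Up.
have [||e e0|g [lg fg]] := rigidity a0 a1
  (@conj_preserves q (f q)) _ (conj_infpt q) _ rho0 Vrho.
- by rewrite /preimage /= of_inf_infpt.
- move=> z w Uz Uw /(can_inj (@to_infK _ (f q))) /(finj _ _ Uz Uw).
  exact: (can_inj (@of_infK _ q)).
- have fpq : f p <> f q by move=> /(finj _ _ Up Uq).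
  pose l := chart (f q) (f p).
  have near_l : nbhs l [set y : R[i]^o | normc (y - l) < e].
    by apply/nbhs_normc; exists e.
  have near_p : nbhs (ichart q (chart q p))
      [set y | normc (chart (f q) (f y) - l) < e].
    by rewrite chartK //; exact: (cf Up (chart_continuous fpq near_l)).
  have := ichart_continuous near_p.
  case/nbhs_normc => eta eta0 h; exists eta => // u ue.
  by rewrite /conj_at /comp !chart_to_inf !of_inf_finpt chartK //; exact: h.
(* The coordinate changes that sent [q] and [f q] to infinity are undone. *)
pose g' := of_inf (f q) \o (g \o to_inf q).
exists g'; split.
  have lo := is_lin_frac_of_inf (f q); have lt := is_lin_frac_to_inf q.
  case: lg => [lg|[ima [h lh gE]]]; [left|right].
    exact: is_lin_frac_comp lo (is_lin_frac_comp lg lt).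
  split => //; apply: moebius_mul; first exact: is_lin_frac_moebius.
  apply: moebius_mul; last exact: is_lin_frac_moebius.
  rewrite gE; apply: moebius_mul; first exact: is_lin_frac_moebius.
  by apply: moebius_reflection; constructor; rewrite oner_eq0.
move=> z Uz; rewrite /g' /comp -fg.
  by rewrite /conj_at /comp !to_infK.
by rewrite /preimage /= to_infK.
Qed.

End Fibers.

Theorem theorem3 (R : realType) (alpha : sphere R)
    (halpha0 : alpha <> finpt 0) (halpha1 : alpha <> finpt 1)
    (halphaoo : alpha <> infpt)
    (U : set (sphere R)) (hU : domain U)
    (f : sphere R -> sphere R) (hcont : {within U, continuous f})
    (hphi : phi_cond alpha U f) :
  (constant_on U f \/
     exists g : sphere R -> sphere R,
       moebius g /\ forall z, U z -> f z = g z)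
  /\
  (~ is_real_point alpha ->
     constant_on U f \/
     exists g : sphere R -> sphere R,
       is_lin_frac g /\ forall z, U z -> f z = g z).
Proof.
case: hU => -[q Uq] oU cU.
case: alpha halpha0 halpha1 halphaoo hphi => [a|//] a0 a1 _ hphi.
have {}a0 : a != 0 by apply: contra_not_neq a0 => ->.
have {}a1 : a != 1 by apply: contra_not_neq a1 => ->.
have pf := phi_preserves_cross a0 a1 hphi.
have cf z : U z -> {for z, continuous f}.
  move=> Uz; move: hcont; rewrite continuous_open_subspace // => /(_ z).
  by rewrite inE; exact.
have [finj|] := pselect (forall z w, U z -> U w -> f z = f w -> z = w); last first.
  move=> ninj; suff cst : constant_on U f by split; [left|move=> _; left].
  apply: contrapT => ncst; apply: ninj => z w Uz Uw fzw.
  apply: contrapT => zw; apply: ncst.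
  exact: (noninjective_constant a0 a1 pf oU cf cU Uw Uz zw fzw).
have [g [lg fg]] := injective_rigidity a0 a1 pf oU cf finj Uq.
split=> [|nreal]; right; exists g; split => //.
  by case: lg => [/is_lin_frac_moebius|[]].
(* The alternative to a linear-fractional map requires Im(a) = 0, which is excluded here. *)
case: lg => [//|[ima _]]; case: nreal; exists (Re a); congr finpt.
by case: a ima {a0 a1 hphi pf} => x y /= ->.
Qed.
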